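(* Let $P:\mathbb{C}\to\mathbb{C}^{m\times m}$ be a symmetric, real, rational, proper, D-NI system with no poles at $+1$ and $-1$, and let $Q:\mathbb{C}\to\mathbb{C}^{m\times m}$ be a symmetric, real, rational, proper, D-WSNI system. Suppose $P(-1)Q(-1)=0$ and $Q(-1)\ge0$. Then $$[P,Q]\text{ is internally stable}\quad\Longleftrightarrow\quad \bar\lambda\big(P(1)Q(1)\big)<1.$$
   Context: $i$ is the imaginary unit; $A^*$ is the conjugate transpose; $\ge0$ and $>0$ (likewise $\le0$) denote positive semidefiniteness and positive definiteness of Hermitian matrices. $\bar\lambda(A)$ is the largest eigenvalue of a square matrix $A$ that has only real eigenvalues. A rational transfer function is real if its entries are rational functions with real coefficients, symmetric if $G(z)=G(z)^\top$, and proper if $G(\infty)$ is finite. $[P,Q]$ denotes the (discrete-time) positive feedback interconnection of $P$ and $Q$: $e_1=w_1+Q e_2$, $e_2=w_2+P e_1$, with exogenous inputs $w_1,w_2$. Internal stability has its standard meaning: all internal and output signals are energy-bounded for all energy-bounded exogenous inputs, i.e. the interconnection is well posed and the transfer function from $(w_1,w_2)$ to $(e_1,e_2)$ has all its poles in $|z|<1$. D-NI (discrete negative imaginary): a real transfer function $G$ that is analytic in $\{|z|>1\}$ and such that, for all $z$ with $|z|>1$: $i[G(z)-G(z)^*]\ge0$ if $\mathrm{Im}\,z>0$; $i[G(z)-G(z)^*]=0$ if $\mathrm{Im}\,z=0$; $i[G(z)-G(z)^*]\le0$ if $\mathrm{Im}\,z<0$. D-WSNI (discrete weakly strictly negative imaginary):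 a real, rational, proper transfer function $G$ with all its poles of magnitude strictly less than one and with $i[G(e^{i\theta})-G(e^{i\theta})^*]>0$ for all $\theta\in(0,\pi)$. *)

(* Defs.v *)
From HB Require Import structures.
From mathcomp Require Import all_boot all_order all_algebra.
From mathcomp Require Import complex.
From mathcomp Require Import all_classical all_reals all_analysis.
Set Implicit Arguments.
Unset Strict Implicit.
Unset Printing Implicit Defensive.
Import Order.TTheory GRing.Theory Num.Theory.
Local Open Scope classical_set_scope.
Local Open Scope quotient_scope.
Local Open Scope sesquilinear_scope.
Local Open Scope complex_scope.
Local Open Scope ring_scope.

Section Matrices.
Context {R : realType} {m : nat}.
Implicit Type A : 'M[R[i]]_m.

(* The order on R[i] is partial: 0 <= x and 0 < x entail that x is real. *)
Definition psdmx A : Prop :=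
  A \is hermsymmx /\ forall v : 'cV[R[i]]_m, 0 <= (v^t* *m A *m v) 0 0.

Definition pdmx A : Prop :=
  A \is hermsymmx /\
  forall v : 'cV[R[i]]_m, v != 0 -> 0 < (v^t* *m A *m v) 0 0.

Definition has_real_spectrum A : Prop :=
  forall a : R[i], eigenvalue A a -> a \is Num.real.

(* When 0 < m and A has only real eigenvalues, this is the supremum of a
   nonempty finite set, hence a maximum. *)
Definition largest_eigenvalue A : R := sup [set x : R | eigenvalue A x%:C].

End Matrices.

Section RationalFunctions.
Context {R : realType}.
Implicit Type f : {fraction {poly R}}.

(* Lowest-terms numerator and denominator, unique up to a common nonzero
   scalar: [repr f] is an arbitrary representative of [f], possibly with
   common factors, so it cannot be used directly to read off the poles. *)
Definition ratnum f : {poly R} :=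
  (repr f).1 %/ gcdp (repr f).1 (repr f).2.

Definition ratden f : {poly R} :=
  (repr f).2 %/ gcdp (repr f).1 (repr f).2.

Definition ratpole f (z : R[i]) : bool :=
  root (map_poly (real_complex R) (ratden f)) z.

(* Only meaningful where [f] has no pole. *)
Definition rateval f (z : R[i]) : R[i] :=
  (map_poly (real_complex R) (ratnum f)).[z] /
  (map_poly (real_complex R) (ratden f)).[z].

Definition ratproper f : bool := (size (ratnum f) <= size (ratden f))%N.

End RationalFunctions.

(* Real rational transfer functions of size n x n, as matrices over R(z). *)
Definition tfmx (R : realType) (n : nat) := 'M[{fraction {poly R}}]_n.

Section TransferFunctions.
Context {R : realType} {n : nat}.
Implicit Type G : tfmx R n.

Definition tf_pole G (z : R[i]) : Prop := exists i j, ratpole (G i j) z.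

Definition tf_eval G (z : R[i]) : 'M[R[i]]_n := map_mx (rateval^~ z) G.

Definition tf_symmetric G : Prop := G^T = G.

Definition tf_proper G : Prop := forall i j, ratproper (G i j).

(* i [G(z) - G(z)^*] *)
Definition tf_imag G (z : R[i]) : 'M[R[i]]_n :=
  'i%C *: (tf_eval G z - (tf_eval G z)^t*).

(* A rational function is analytic on an open set iff it has no pole there. *)
Definition D_NI G : Prop :=
  (forall z : R[i], 1 < `|z| -> ~ tf_pole G z) /\
  (forall z : R[i], 1 < `|z| ->
    [/\ 0 < complex.Im z -> psdmx (tf_imag G z),
        complex.Im z = 0 -> tf_imag G z = 0
      & complex.Im z < 0 -> psdmx (- tf_imag G z)]).

Definition D_WSNI G : Prop :=
  [/\ tf_proper G,
      forall z : R[i], tf_pole G z -> `|z| < 1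
    & forall theta : R, 0 < theta < pi ->
        pdmx (tf_imag G (cos theta +i* sin theta))].

End TransferFunctions.

Section Interconnection.
Context {R : realType} {m : nat}.
Variables P Q : tfmx R m.

(* The loop equations e1 = w1 + Q e2, e2 = w2 + P e1 read
   loop_mx *m (e1; e2) = (w1; w2). *)
Definition loop_mx : tfmx R (m + m) := block_mx 1%:M (- Q) (- P) 1%:M.

Definition closed_loop : tfmx R (m + m) := invmx loop_mx.

(* The map from (w1, w2) to (e1, e2) exists and is proper (causal). *)
Definition well_posed : Prop := loop_mx \in unitmx /\ tf_proper closed_loop.

Definition internally_stable : Prop :=
  well_posed /\ forall z : R[i], tf_pole closed_loop z -> `|z| < 1.

End Interconnection.

(* Main.v *)
Require Import Defs.
From mathcomp Require Import all_boot all_order all_algebra.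
From mathcomp Require Import complex.
From mathcomp Require Import all_classical all_reals all_analysis.
From mathcomp Require Import ring lra.
Import Order.TTheory GRing.Theory Num.Theory.
Import numFieldNormedType.Exports.
Import ComplexField.Normc.
Set Implicit Arguments.
Unset Strict Implicit.
Unset Printing Implicit Defensive.
Local Open Scope classical_set_scope.
Local Open Scope sesquilinear_scope.
Local Open Scope complex_scope.
Local Open Scope ring_scope.

(** The variable u = 1/z turns the region of instability, |z| >= 1 together
    with infinity, into the closed unit disc.  Write A(u) and B(u) for the values
    of P and Q at 1/u.  In the upper half of the open disc the D-NI property reads
    Im (v^* A(u) v) >= 0; in the upper half of the closed disc the D-WSNI property
    gives Im (v^* B(u) v) > 0 for v <> 0.  On the boundary arc the latter is the
    definition; inside it is the maximum principle for the rational function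
    v^* B(u) v, which is real on the diameter ([half_disc_im_gt0],
    [DWSNI_Im]).

    Off the real axis the loop is harmless, whatever the gains at z = 1 are.  If
    e1 = w1 + B e2 and e2 = w2 + A e1, then e1^* e2 and e2^* e1 have opposite
    imaginary parts, while those of e1^* A e1 and e2^* B e2 are nonnegative, the
    second one at least d |e2|^2.  Hence e1 and e2 are bounded by w1 and w2
    ([energy_balance]), the inverse of the loop stays bounded on a segment that
    ends at u, and a rational function that is bounded on such a segment has no
    pole at its end ([valV_bounded]).  This covers the points of the unit circle
    where P itself has poles.

    On the real diameter A(x) and B(x) are Hermitian and free of poles.  A real
    rational function whose imaginary part is nonnegative in the upper half disc
    has a nonnegative derivative on (-1, 1), so the forms of A and B increase with
    x, strictly for B ([segment_ndecr], [segment_incr]); as B(-1) >= 0, B(x) is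
    positive definite for x > -1.  Therefore the closed loop is stable exactly when
    I - A(x) B(x) is nonsingular for every x in [-1, 1].

    It remains to compare this with the gains at x = 1, that is z = 1, through the
    Hermitian matrix M(x) = B(x) - B(x) A(x) B(x), which is congruent to
    B(x)^-1 - A(x).  The eigenvalues of A(1) B(1) are real, and they are all
    smaller than 1 iff M(1) > 0.
    - If M(1) > 0, then for x > -1, since A(x) <= A(1) and B(x)^-1 >= B(1)^-1,
      no I - A(x) B(x) is singular ([nonsingular_mono]); at x = -1 the product
      A(x) B(x) vanishes.
    - If no I - A(x) B(x) is singular, then M(x) > 0 for x > -1 close to -1,
      because A(x) B(x) is small there, and positive definiteness cannot be lost
      along a path of nonsingular Hermitian matrices ([pd_path]), so M(1) > 0. *)

(** * Limits of complex-valued functions *)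

Section ComplexLimits.
Context {R : realType}.
Local Notation C := R[i].
Implicit Types x y z : C.

Lemma cReD x y : complex.Re (x + y) = complex.Re x + complex.Re y.
Proof. by case: x; case: y. Qed.

Lemma cImD x y : complex.Im (x + y) = complex.Im x + complex.Im y.
Proof. by case: x; case: y. Qed.

Lemma cReN x : complex.Re (- x) = - complex.Re x.
Proof. by case: x. Qed.

Lemma cImN x : complex.Im (- x) = - complex.Im x.
Proof. by case: x. Qed.

Lemma cReM x y :
  complex.Re (x * y) = complex.Re x * complex.Re y - complex.Im x * complex.Im y.
Proof. by case: x; case: y. Qed.

Lemma cImM x y :
  complex.Im (x * y) = complex.Re x * complex.Im y + complex.Im x * complex.Re y.
Proof. by case: x; case: y. Qed.

Lemma cReV x :
  complex.Re x^-1 = complex.Re x / (complex.Re x ^+ 2 + complex.Im x ^+ 2).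
Proof. by case: x. Qed.

Lemma cImV x :
  complex.Im x^-1 = - (complex.Im x / (complex.Re x ^+ 2 + complex.Im x ^+ 2)).
Proof. by case: x. Qed.

Lemma cReJ x : complex.Re x^* = complex.Re x.
Proof. by case: x. Qed.

Lemma cImJ x : complex.Im x^* = - complex.Im x.
Proof. by case: x. Qed.

Lemma complex_eqP x y :
  complex.Re x = complex.Re y -> complex.Im x = complex.Im y -> x = y.
Proof. by case: x => a b; case: y => c d /= -> ->. Qed.

Lemma normr_normc x : `|x| = (normc x)%:C.
Proof. by case: x. Qed.

Lemma normc_sqrt x :
  normc x = Num.sqrt (complex.Re x ^+ 2 + complex.Im x ^+ 2).
Proof. by case: x. Qed.

Lemma normc_ge0 x : 0 <= normc x.
Proof. by rewrite normc_sqrt sqrtr_ge0. Qed.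

Lemma normc_sqr x : normc x ^+ 2 = complex.Re x ^+ 2 + complex.Im x ^+ 2.
Proof. by rewrite normc_sqrt sqr_sqrtr // addr_ge0 // sqr_ge0. Qed.

Lemma normc_eq0 x : (normc x == 0) = (x == 0).
Proof.
apply/eqP/eqP => [/eq0_normc//|->]; exact: normc0.
Qed.

Lemma normc_ler_Re x : `|complex.Re x| <= normc x.
Proof. by rewrite normc_sqrt -sqrtr_sqr ler_wsqrtr // lerDl sqr_ge0. Qed.

Lemma normc_ler_Im x : `|complex.Im x| <= normc x.
Proof. by rewrite normc_sqrt -sqrtr_sqr ler_wsqrtr // lerDr sqr_ge0. Qed.

Lemma normc_geNRe x : - complex.Re x <= normc x.
Proof. by apply: le_trans (normc_ler_Re _); rewrite -normrN ler_norm. Qed.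

Lemma normc_geNIm x : - complex.Im x <= normc x.
Proof. by apply: le_trans (normc_ler_Im _); rewrite -normrN ler_norm. Qed.

(** Convergence in R[i], by components, which reduces it to limits in R. *)
Definition ccvg {T : Type} (F : set_system T) (f : T -> C) (l : C) : Prop :=
  ((fun t => complex.Re (f t)) @ F --> complex.Re l) /\
  ((fun t => complex.Im (f t)) @ F --> complex.Im l).

Section Filter.
Context {T : Type} {F : set_system T} {FF : Filter F}.
Implicit Types (f g : T -> C).

Lemma ccvg_cst l : ccvg F (fun=> l) l.
Proof. by split; exact: cvg_cst. Qed.

Lemma ccvgN f l : ccvg F f l -> ccvg F (fun t => - f t) (- l).
Proof.
case=> fR fI; split; rewrite ?cReN ?cImN.
  by under eq_fun do rewrite cReN; exact: cvgN.
by under eq_fun do rewrite cImN; exact: cvgN.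
Qed.

Lemma ccvgD f g l m : ccvg F f l -> ccvg F g m ->
  ccvg F (fun t => f t + g t) (l + m).
Proof.
case=> fR fI [gR gI]; split; rewrite ?cReD ?cImD.
  by under eq_fun do rewrite cReD; exact: cvgD.
by under eq_fun do rewrite cImD; exact: cvgD.
Qed.

Lemma ccvgB f g l m : ccvg F f l -> ccvg F g m ->
  ccvg F (fun t => f t - g t) (l - m).
Proof. by move=> fl gm; apply: ccvgD => //; exact: ccvgN. Qed.

Lemma ccvgM f g l m : ccvg F f l -> ccvg F g m ->
  ccvg F (fun t => f t * g t) (l * m).
Proof.
case=> fR fI [gR gI]; split; rewrite ?cReM ?cImM.
  by under eq_fun do rewrite cReM; apply: cvgB; exact: cvgM.
by under eq_fun do rewrite cImM; apply: cvgD; exact: cvgM.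
Qed.

Lemma ccvgV f l : l != 0 -> ccvg F f l -> ccvg F (fun t => (f t)^-1) l^-1.
Proof.
move=> l0 [fR fI].
have q0 : complex.Re l ^+ 2 + complex.Im l ^+ 2 != 0.
  by rewrite -normc_sqr sqrf_eq0 normc_eq0.
have fq : (fun t => ((complex.Re (f t)) ^+ 2 + (complex.Im (f t)) ^+ 2)^-1) @ F
    --> (complex.Re l ^+ 2 + complex.Im l ^+ 2)^-1.
  apply: cvgV => //; apply: cvgD; rewrite expr2; under eq_fun do rewrite expr2;
    exact: cvgM.
split; rewrite ?cReV ?cImV.
  by under eq_fun do rewrite cReV; exact: cvgM.
by under eq_fun do rewrite cImV; apply: cvgN; exact: cvgM.
Qed.

Lemma ccvg_sum (I : Type) (r : seq I) (f : I -> T -> C) (l : I -> C) :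
  (forall i, ccvg F (f i) (l i)) ->
  ccvg F (fun t => \sum_(i <- r) f i t) (\sum_(i <- r) l i).
Proof.
move=> fl; elim: r => [|i r IH].
  by rewrite big_nil; under eq_fun do rewrite big_nil; exact: ccvg_cst.
by rewrite big_cons; under eq_fun do rewrite big_cons; exact: ccvgD.
Qed.

Lemma ccvg_horner (p : {poly C}) f l :
  ccvg F f l -> ccvg F (fun t => p.[f t]) p.[l].
Proof.
move=> fl; elim/poly_ind: p => [|p c IH].
  by rewrite horner0; under eq_fun do rewrite horner0; exact: ccvg_cst.
rewrite hornerMXaddC; under eq_fun do rewrite hornerMXaddC.
by apply: ccvgD; [exact: ccvgM | exact: ccvg_cst].
Qed.

Lemma ccvg_normc f l : ccvg F f l -> (fun t => normc (f t)) @ F --> normc l.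
Proof.
case=> fR fI; rewrite normc_sqrt; under eq_fun do rewrite normc_sqrt.
have q : (fun t => complex.Re (f t) ^+ 2 + complex.Im (f t) ^+ 2) @ F
    --> complex.Re l ^+ 2 + complex.Im l ^+ 2.
  by apply: cvgD; rewrite expr2; under eq_fun do rewrite expr2; exact: cvgM.
exact: (cvg_comp _ _ q (@sqrt_continuous R _)).
Qed.

Lemma ccvg_neq0 f l : l != 0 -> ccvg F f l -> \forall t \near F, f t != 0.
Proof.
rewrite -normc_eq0 => l0 /ccvg_normc fl.
have lt0 : 0 < normc l by rewrite lt_def l0 normc_ge0.
have h : \forall t \near F, 0 < normc (f t).
  exact: (@cvgr_gt R T F FF _ _ fl _ lt0).
by apply: filterS h => t; rewrite -normc_eq0 lt_def => /andP[].
Qed.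

Lemma near_eq_ccvg f g l : (\forall t \near F, f t = g t) ->
  ccvg F f l -> ccvg F g l.
Proof.
move=> fg [fR fI]; split.
  by apply: cvg_trans fR; apply: near_eq_cvg; apply: filterS fg => t ->.
by apply: cvg_trans fI; apply: near_eq_cvg; apply: filterS fg => t ->.
Qed.

End Filter.

Lemma ccvg_unique {T : Type} {F : set_system T} {FF : ProperFilter F} (f : T -> C) l m :
  ccvg F f l -> ccvg F f m -> l = m.
Proof.
move=> [fR fI] [gR gI]; apply: complex_eqP.
  exact: cvg_unique fR gR.
exact: cvg_unique fI gI.
Qed.

End ComplexLimits.

(** * Norms and limits of complex matrices *)

Section MatrixNorm.
Context {R : realType}.
Local Notation C := R[i].

(** The sum of the moduli of the entries: a submultiplicative norm with real
    values, defined for all shapes, including empty ones. *)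
Definition l1norm (m n : nat) (A : 'M[C]_(m, n)) : R := \sum_i \sum_j normc (A i j).

Lemma l1norm_ge0 m n (A : 'M[C]_(m, n)) : 0 <= l1norm A.
Proof. by apply: sumr_ge0 => i _; apply: sumr_ge0 => j _; exact: normc_ge0. Qed.

Lemma normc_le_l1norm m n (A : 'M[C]_(m, n)) i j : normc (A i j) <= l1norm A.
Proof.
rewrite /l1norm (bigD1 i) //= (bigD1 j) //= -addrA lerDl addr_ge0 //.
  by apply: sumr_ge0 => k _; exact: normc_ge0.
by apply: sumr_ge0 => k _; apply: sumr_ge0 => l _; exact: normc_ge0.
Qed.

Lemma l1norm_eq0 m n (A : 'M[C]_(m, n)) : (l1norm A == 0) = (A == 0).
Proof.
apply/eqP/eqP => [A0|->]; last first.
  by rewrite /l1norm big1 // => i _; rewrite big1 // => j _; rewrite mxE normc0.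
apply/matrixP => i j; rewrite mxE; apply: eq0_normc.
by apply/eqP; rewrite eq_le normc_ge0 -A0 normc_le_l1norm.
Qed.

Lemma l1norm_gt0 m n (A : 'M[C]_(m, n)) : (0 < l1norm A) = (A != 0).
Proof. by rewrite lt_def l1norm_ge0 l1norm_eq0 andbT. Qed.

Lemma normc_sum (I : Type) (r : seq I) (f : I -> C) :
  normc (\sum_(i <- r) f i) <= \sum_(i <- r) normc (f i).
Proof.
elim: r => [|i r IH]; first by rewrite !big_nil normc0.
by rewrite !big_cons; apply: (le_trans (le_normcD _ _)); rewrite lerD2l.
Qed.

Lemma l1normM m n p (A : 'M[C]_(m, n)) (B : 'M[C]_(n, p)) :
  l1norm (A *m B) <= l1norm A * l1norm B.
Proof.
rewrite {2}/l1norm mulr_suml; apply: ler_sum => i _.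
rewrite mulr_suml.
apply: (@le_trans _ _ (\sum_k \sum_j normc (A i j) * normc (B j k))).
  apply: ler_sum => k _; rewrite mxE; apply: (le_trans (normc_sum _ _)).
  by apply: ler_sum => j _; rewrite normcM.
rewrite exchange_big; apply: ler_sum => j _ /=; rewrite -mulr_sumr.
apply: ler_wpM2l; first exact: normc_ge0.
rewrite /l1norm [leRHS](bigD1 j) //= lerDl.
by apply: sumr_ge0 => l _; apply: sumr_ge0 => k _; exact: normc_ge0.
Qed.

Lemma l1normD m n (A B : 'M[C]_(m, n)) : l1norm (A + B) <= l1norm A + l1norm B.
Proof.
rewrite /l1norm -big_split; apply: ler_sum => i _ /=.
by rewrite -big_split; apply: ler_sum => j _ /=; rewrite mxE le_normcD.
Qed.

Lemma l1normN m n (A : 'M[C]_(m, n)) : l1norm (- A) = l1norm A.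
Proof. by apply: eq_bigr => i _; apply: eq_bigr => j _; rewrite mxE normcN. Qed.

Lemma l1norm_col m p n (A : 'M[C]_(m, n)) (B : 'M[C]_(p, n)) :
  l1norm (col_mx A B) = l1norm A + l1norm B.
Proof.
rewrite /l1norm big_split_ord; congr (_ + _); apply: eq_bigr => i _;
  by apply: eq_bigr => j _; rewrite ?col_mxEu ?col_mxEd.
Qed.

Lemma normc_conj (x : C) : normc x^* = normc x.
Proof. by case: x => a b /=; rewrite sqrrN. Qed.

Lemma l1norm_adj m n (A : 'M[C]_(m, n)) : l1norm (A^t*) = l1norm A.
Proof.
rewrite /l1norm exchange_big; apply: eq_bigr => i _; apply: eq_bigr => j _.
by rewrite !mxE normc_conj.
Qed.

Lemma adjM m n p (A : 'M[C]_(m, n)) (B : 'M[C]_(n, p)) :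
  (A *m B)^t* = B^t* *m A^t*.
Proof. by rewrite trmx_mul map_mxM. Qed.

Lemma adjK m n (A : 'M[C]_(m, n)) : A^t*^t* = A.
Proof. by apply/matrixP => i j; rewrite !mxE conjCK. Qed.

Lemma hermP n (A : 'M[C]_n) : A \is hermsymmx <-> A^t* = A.
Proof.
split=> [/is_hermitianmxP|AA]; first by rewrite expr0 scale1r.
by apply/is_hermitianmxP; rewrite expr0 scale1r.
Qed.

Lemma cvg_sumR {T : Type} (F : set_system T) {FF : Filter F} (I : Type)
    (r : seq I) (f : I -> T -> R) (l : I -> R) :
  (forall i, f i @ F --> l i) ->
  (fun t => \sum_(i <- r) f i t) @ F --> \sum_(i <- r) l i.
Proof.
move=> fl; elim: r => [|i r IH].
  by rewrite big_nil; under eq_fun do rewrite big_nil; exact: cvg_cst.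
by rewrite big_cons; under eq_fun do rewrite big_cons; exact: cvgD.
Qed.

Definition mcvg {T : Type} (F : set_system T) m n
    (f : T -> 'M[C]_(m, n)) (L : 'M[C]_(m, n)) :=
  forall i j, ccvg F (fun t => f t i j) (L i j).

Lemma mcvg_l1norm {T : Type} (F : set_system T) {FF : Filter F} m n
    (f : T -> 'M[C]_(m, n)) (L : 'M[C]_(m, n)) :
  mcvg F f L -> forall e, 0 < e -> \forall t \near F, l1norm (f t - L) < e.
Proof.
move=> fL e e0.
have h : (fun t => l1norm (f t - L)) @ F -->
    \sum_(i < m) \sum_(j < n) normc (L i j - L i j).
  apply: cvg_sumR => i; apply: cvg_sumR => j.
  under eq_fun do rewrite !mxE.
  by apply: ccvg_normc; apply: ccvgB; [exact: fL | exact: ccvg_cst].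
apply: (@cvgr_lt R T F FF _ _ h).
rewrite big1 // => i _; rewrite big1 // => j _; by rewrite subrr normc0.
Qed.

Lemma mcvg_mul {T : Type} (F : set_system T) {FF : Filter F} m n p
    (f : T -> 'M[C]_(m, n)) (g : T -> 'M[C]_(n, p))
    (L : 'M[C]_(m, n)) (M : 'M[C]_(n, p)) :
  mcvg F f L -> mcvg F g M -> mcvg F (fun t => f t *m g t) (L *m M).
Proof.
move=> fL gM i k; rewrite mxE; under eq_fun do rewrite mxE.
by apply: ccvg_sum => j; exact: ccvgM.
Qed.

Lemma mcvgB {T : Type} (F : set_system T) {FF : Filter F} m n
    (f g : T -> 'M[C]_(m, n)) (L M : 'M[C]_(m, n)) :
  mcvg F f L -> mcvg F g M -> mcvg F (fun t => f t - g t) (L - M).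
Proof.
move=> fL gM i k; rewrite !mxE; under eq_fun do rewrite !mxE.
exact: ccvgB.
Qed.

Lemma mcvg_cst {T : Type} (F : set_system T) {FF : Filter F} m n (L : 'M[C]_(m, n)) :
  mcvg F (fun=> L) L.
Proof. by move=> i j; exact: ccvg_cst. Qed.

Lemma mcvgZ {T : Type} (F : set_system T) {FF : Filter F} m n
    (c : T -> C) (f : T -> 'M[C]_(m, n)) a (L : 'M[C]_(m, n)) :
  ccvg F c a -> mcvg F f L -> mcvg F (fun t => c t *: f t) (a *: L).
Proof.
move=> ca fL i k; rewrite !mxE; under eq_fun do rewrite !mxE.
exact: ccvgM.
Qed.

End MatrixNorm.

(** * Hermitian forms and positive definiteness *)

Lemma unitmx_cVP (K : fieldType) n (A : 'M[K]_n) :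
  reflect (forall v : 'cV[K]_n, A *m v = 0 -> v = 0) (A \in unitmx).
Proof.
apply: (iffP idP) => [Au v Av|inj]; first by rewrite -(mulKmx Au v) Av mulmx0.
rewrite -unitmx_tr -row_free_unit -kermx_eq0; apply/eqP.
apply/row_matrixP => i; rewrite row0; apply: trmx_inj; rewrite trmx0.
apply: inj; apply: trmx_inj; rewrite trmx_mul trmxK trmx0.
by rewrite -row_mul mulmx_ker row0.
Qed.

Section Forms.
Context {R : realType} {n : nat}.
Local Notation C := R[i].
Implicit Types (A B : 'M[C]_n) (u v w : 'cV[C]_n).

Definition sesq A u v : C := (u^t* *m A *m v) 0 0.

Lemma sesqJ A u v : (sesq A u v)^* = sesq (A^t*) v u.
Proof.
rewrite /sesq -[LHS]/(Num.conj _).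
have -> : v^t* *m A^t* *m u = (u^t* *m A *m v)^t* by rewrite !adjM adjK mulmxA.
by rewrite !mxE.
Qed.

Lemma sesqDl A u v w : sesq A (u + v) w = sesq A u w + sesq A v w.
Proof. by rewrite /sesq linearD /= map_mxD !mulmxDl mxE. Qed.

Lemma sesqDr A u v w : sesq A u (v + w) = sesq A u v + sesq A u w.
Proof. by rewrite /sesq mulmxDr mxE. Qed.

Lemma sesqNr A u v : sesq A u (- v) = - sesq A u v.
Proof. by rewrite /sesq mulmxN mxE. Qed.

Lemma sesqNl A u v : sesq A (- u) v = - sesq A u v.
Proof. by rewrite /sesq linearN /= map_mxN !mulNmx mxE. Qed.

Lemma sesqZl A a u v : sesq A (a *: u) v = a^* * sesq A u v.
Proof. by rewrite /sesq linearZ /= map_mxZ -!scalemxAl mxE. Qed.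

Lemma sesqZr A a u v : sesq A u (a *: v) = a * sesq A u v.
Proof. by rewrite /sesq -scalemxAr mxE. Qed.

Lemma sesq0r A u : sesq A u 0 = 0.
Proof. by rewrite /sesq mulmx0 mxE. Qed.

Lemma sesqMDl A B u v : sesq (A + B) u v = sesq A u v + sesq B u v.
Proof. by rewrite /sesq mulmxDr mulmxDl mxE. Qed.

Lemma sesqMN A u v : sesq (- A) u v = - sesq A u v.
Proof. by rewrite /sesq mulmxN mulNmx mxE. Qed.

Lemma sesqMZ A a u v : sesq (a *: A) u v = a * sesq A u v.
Proof. by rewrite /sesq -scalemxAr -scalemxAl mxE. Qed.

Lemma sesq_1 A u v : sesq A u v = sesq 1%:M u (A *m v).
Proof. by rewrite /sesq mulmx1 mulmxA. Qed.

Lemma sesq_mul A B u v : sesq (A *m B) u v = sesq A u (B *m v).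
Proof. by rewrite /sesq !mulmxA. Qed.

Lemma sesq_mull A B u v : sesq (A *m B) u v = sesq B (A^t* *m u) v.
Proof. by rewrite /sesq adjM adjK !mulmxA. Qed.

Lemma normc_sesq A u v : normc (sesq A u v) <= l1norm A * (l1norm u * l1norm v).
Proof.
rewrite /sesq; apply: (le_trans (normc_le_l1norm _ _ _)).
apply: (le_trans (l1normM _ _)); rewrite mulrA ler_wpM2r ?l1norm_ge0 // mulrC.
by apply: (le_trans (l1normM _ _)); rewrite l1norm_adj.
Qed.

Lemma herm_sesq_Im A v : A^t* = A -> complex.Im (sesq A v v) = 0.
Proof.
move=> AA; have := congr1 (@complex.Im R) (sesqJ A v v).
by rewrite AA cImJ => h; lra.
Qed.

Lemma sesq11 v : sesq 1%:M v v = \sum_i (normc (v i 0) ^+ 2)%:C.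
Proof.
rewrite /sesq mulmx1 mxE; apply: eq_bigr => i _; rewrite !mxE.
by apply: complex_eqP; rewrite ?cReM ?cImM normc_sqr /=; case: (v i 0) => a b /=; ring.
Qed.

Lemma sesq11_gt0 v : v != 0 -> 0 < complex.Re (sesq 1%:M v v).
Proof.
move=> v0.
have [i vi] : exists i, v i 0 != 0.
  apply/existsP; rewrite -[X in is_true X]negbK negb_exists; apply: contra v0.
  move=> /forallP v0; apply/eqP/matrixP => i j; rewrite !mxE ord1; apply/eqP.
  by have := v0 i; rewrite negbK.
rewrite sesq11 -(rmorph_sum (real_complex R)) /= (bigD1 i) //=.
rewrite ltr_pwDl // ?exprn_gt0 // ?lt_def ?normc_ge0 ?normc_eq0 ?vi //.
by apply: sumr_ge0 => j _; rewrite sqr_ge0.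
Qed.

Lemma psdmxP A : psdmx A <-> A^t* = A /\ forall v, 0 <= complex.Re (sesq A v v).
Proof.
split=> [[/hermP AA h]|[AA h]]; split=> //.
- by move=> v; have := h v; rewrite lecE => /andP[].
- exact/hermP.
- by move=> v; rewrite lecE h andbT; apply/eqP/herm_sesq_Im.
Qed.

Lemma pdmxP A :
  pdmx A <-> A^t* = A /\ forall v, v != 0 -> 0 < complex.Re (sesq A v v).
Proof.
split=> [[/hermP AA h]|[AA h]]; split=> //.
- by move=> v /h; rewrite ltcE => /andP[].
- exact/hermP.
- by move=> v v0; rewrite ltcE h // andbT; apply/eqP/herm_sesq_Im.
Qed.

Lemma pd_inj A v : pdmx A -> A *m v = 0 -> v = 0.
Proof.
move=> /pdmxP[_ h] Av; apply/eqP/negP => /negP/h.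
by rewrite sesq_1 Av sesq0r ltxx.
Qed.

(** As usual, positivity is applied to q u - b v with q = v^* A v and
    b = v^* A u. *)
Lemma pd_cauchy_schwarz A u v : pdmx A ->
  normc (sesq A u v) ^+ 2 <=
    complex.Re (sesq A u u) * complex.Re (sesq A v v).
Proof.
move=> /pdmxP[AA h].
have [->|v0] := eqVneq v 0.
  by rewrite !sesq0r normc0 expr0n /= mulr0.
have q0 := h _ v0.
have h0 : 0 <= complex.Re (sesq A
    ((complex.Re (sesq A v v))%:C *: u - sesq A v u *: v)
    ((complex.Re (sesq A v v))%:C *: u - sesq A v u *: v)).
  set w := _ - _; have [->|/h/ltW//] := eqVneq w 0.
  by rewrite sesq0r.
have vu : sesq A v u = (sesq A u v)^* by rewrite sesqJ AA.
have iv := herm_sesq_Im v AA; have iu := herm_sesq_Im u AA.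
rewrite !(sesqDl, sesqDr, sesqNl, sesqNr, sesqZl, sesqZr) vu in h0.
rewrite normc_sqr.
move: q0 h0 iv iu; case: (sesq A u v) => b1 b2; case: (sesq A v v) => q1 q2.
case: (sesq A u u) => p1 p2 /= q0 + iv iu; rewrite {}iv {}iu => h0.
rewrite -subr_ge0 -(pmulr_rge0 _ q0).
by apply: le_trans h0 _; rewrite le_eqVlt; apply/orP; left; apply/eqP; ring.
Qed.

Lemma pd_unit A : pdmx A -> A \in unitmx.
Proof. by move=> pA; apply/unitmx_cVP => v; exact: pd_inj. Qed.

(** Up to conjugation, the entry v_i is the value of the sesquilinear form of A at v
    and A^-1 e_i, so that Cauchy-Schwarz bounds it by the form at v; summing over i
    gives the constant without compactness of the unit sphere. *)
Lemma pd_coercive A : pdmx A ->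
  exists2 d : R, 0 < d & forall v, d * l1norm v ^+ 2 <= complex.Re (sesq A v v).
Proof.
move=> pA; have /pdmxP[AA h] := pA.
have Au := pd_unit pA.
pose x i : 'cV[C]_n := invmx A *m delta_mx i 0.
pose c i := complex.Re (sesq A (x i) (x i)).
have x0 i : x i != 0.
  apply/eqP => /(congr1 (mulmx A)); rewrite mulKVmx // mulmx0.
  by move=> /matrixP /(_ i 0)/eqP; rewrite !mxE !eqxx oner_eq0.
have c0 i : 0 < c i by apply: h.
have bnd v i : normc (v i 0) <= Num.sqrt (c i) * Num.sqrt (complex.Re (sesq A v v)).
  have -> : normc (v i 0) = normc (sesq A v (x i)).
    rewrite sesq_1 mulKVmx // /sesq mulmx1 -normc_conj; congr normc.
    rewrite mxE (bigD1 i) //= big1 ?addr0 => [|j ji]; last first.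
      by rewrite !mxE (negbTE ji) mulr0.
    by rewrite !mxE !eqxx mulr1.
  rewrite -sqrtrM; last exact: ltW.
  rewrite -[leLHS]ger0_norm ?normc_ge0 // -sqrtr_sqr ler_wsqrtr //.
  by rewrite mulrC; exact: pd_cauchy_schwarz.
pose S := 1 + \sum_i Num.sqrt (c i).
have S1 : 1 <= S by rewrite lerDl sumr_ge0 // => i _; rewrite sqrtr_ge0.
have S0 : 0 < S := lt_le_trans ltr01 S1.
(* S - 1 would do, except that it vanishes in dimension 0. *)
exists (S ^- 2); first by rewrite invr_gt0 exprn_gt0.
move=> v.
have [->|v0] := eqVneq v 0.
  by rewrite (eqP (_ : l1norm 0 == 0)) ?l1norm_eq0 // expr0n mulr0 sesq0r.
have qv := h _ v0.
rewrite mulrC ler_pdivrMr ?exprn_gt0 // -[leRHS]mulrC.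
have le1 : l1norm v <= S * Num.sqrt (complex.Re (sesq A v v)).
  apply: (@le_trans _ _ (\sum_i (Num.sqrt (c i) * Num.sqrt (complex.Re (sesq A v v))))).
    by apply: ler_sum => i _; rewrite big_ord1.
  by rewrite -mulr_suml ler_wpM2r ?sqrtr_ge0 // /S lerDr.
rewrite -[complex.Re (sesq _ _ _)]sqr_sqrtr; last exact: ltW.
rewrite -exprMn.
by rewrite ler_pXn2r // nnegrE ?l1norm_ge0 // mulr_ge0 ?sqrtr_ge0 ?(ltW S0).
Qed.

(** With w = A v, the form at v - t w is t^2 w^* A w - 2 t w^* w, which is negative
    for small t > 0 unless w = 0. *)
Lemma psd_null A v : psdmx A -> complex.Re (sesq A v v) = 0 -> A *m v = 0.
Proof.
move=> /psdmxP[AA h] v0; apply/eqP/negP => /negP w0.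
set w := A *m v in w0 *.
have ww := sesq11_gt0 w0.
have key t : 0 <= t ^+ 2 * complex.Re (sesq A w w) - 2 * t * complex.Re (sesq 1%:M w w).
  have := h (v - t%:C *: w).
  have vw : sesq A v w = sesq 1%:M w w.
    by rewrite sesq_1 /sesq !mulmx1 /w adjM AA !mulmxA.
  have wv : sesq A w v = sesq 1%:M w w by rewrite sesq_1.
  rewrite !(sesqDl, sesqDr, sesqNl, sesqNr, sesqZl, sesqZr) vw wv.
  move: v0 (herm_sesq_Im v AA) (herm_sesq_Im w AA).
  case: (sesq A v v) => a1 a2; case: (sesq A w w) => b1 b2.
  case: (sesq 1%:M w w) => c1 c2 /= a10 a20 b20 hh; rewrite a10 b20 in hh.
   apply: le_trans hh _; rewrite le_eqVlt; apply/orP; left; apply/eqP; ring.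
pose p := complex.Re (sesq A w w); pose q := complex.Re (sesq 1%:M w w).
have p0 : 0 <= p by exact: h.
have := key (q / (p + 1)); rewrite -/p -/q.
have p1 : 0 < p + 1 by exact: ltr_wpDl.
set t := q / (p + 1).
have t0 : 0 < t := divr_gt0 ww p1.
have tq : t * (p + 1) = q by rewrite /t divfK // lt0r_neq0.
rewrite -tq.
have -> : t ^+ 2 * p - 2 * t * (t * (p + 1)) = - (t ^+ 2 * (p + 2)) by ring.
rewrite oppr_ge0 leNgt => /negP; apply.
apply: mulr_gt0; first exact: exprn_gt0.
exact: ltr_wpDl.
Qed.

(** The parameters where H is positive definite form an open set by coercivity.
    The complement is open as well: a nonsingular Hermitian matrix that is not
    positive definite takes a negative value, by [psd_null], and keeps it nearby.
    The line is connected. *)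
Lemma pd_path (H : R -> 'M[C]_n) (a b : R) :
    (forall t, mcvg (nbhs t) H (H t)) ->
    (forall t, (H t)^t* = H t) -> (forall t v, H t *m v = 0 -> v = 0) ->
  pdmx (H a) -> pdmx (H b).
Proof.
move=> Hc HH Hi Ha.
pose P := [set t | pdmx (H t)].
have oP : open P.
  rewrite openE => t /pd_coercive[d d0 hd].
  have near_d : \forall s \near t, l1norm (H s - H t) < d.
    exact: mcvg_l1norm (Hc t) _ d0.
  rewrite /interior.
  apply: filterS near_d => s sd.
  apply/pdmxP; split=> // v v0.
  have -> : H s = H t + (H s - H t) by rewrite addrC subrK.
  rewrite sesqMDl cReD.
  have h1 := hd v.
  have h2 : - complex.Re (sesq (H s - H t) v v) < d * l1norm v ^+ 2.
    apply: (@le_lt_trans _ _ (l1norm (H s - H t) * l1norm v ^+ 2)).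
      exact: le_trans (normc_geNRe _) (normc_sesq _ _ _).
    by rewrite ltr_pM2r // exprn_gt0 // l1norm_gt0.
  by rewrite -ltrBlDr sub0r; exact: lt_le_trans h2 h1.
have oN : open (~` P).
  rewrite openE => t nP.
  have [v hv] : exists v, complex.Re (sesq (H t) v v) < 0.
    apply: contrapT => /forallNP nv; apply: nP.
    have ps : psdmx (H t) by apply/psdmxP; split=> // v; rewrite leNgt; apply/negP/nv.
    apply/pdmxP; split=> // v v0; rewrite lt_def; have /psdmxP[_ ->] := ps.
    rewrite andbT; apply/eqP => /(psd_null ps) /Hi v00.
    by rewrite v00 eqxx in v0.
  have cv : (fun s => complex.Re (sesq (H s) v v)) @ t --> complex.Re (sesq (H t) v v).
    have cm : mcvg (nbhs t) (fun s => v^t* *m H s *m v) (v^t* *m H t *m v).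
      apply: mcvg_mul; last exact: mcvg_cst.
      by apply: mcvg_mul; [exact: mcvg_cst | exact: Hc].
    exact: proj1 (cm 0 0).
  have near_v : \forall s \near t, complex.Re (sesq (H s) v v) < 0.
    exact: @cvgr_lt R R (nbhs t) _ _ _ cv _ hv.
  rewrite /interior; apply: filterS near_v => s /= hs /pdmxP[_ ps].
  have [v00|/ps] := eqVneq v 0; last by move=> /lt_trans/(_ hs); rewrite ltxx.
  by move: hs; rewrite v00 sesq0r ltxx.
have : P = setT.
  have /connected_intervalP cR : is_interval (@setT R) by move=> x y _ _ z _.
  apply: cR; first by exists a.
    by exists P => //; rewrite setTI.
  by exists P; [rewrite -openC | rewrite setTI].
by move=> /seteqP[_ /(_ b I)].
Qed.

End Forms.

(** * Eigenvalues of a product of Hermitian matrices *)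

Section Spectrum.
Context {R : realType} {n : nat}.
Local Notation C := R[i].
Implicit Types (A B M : 'M[C]_n) (u v w : 'cV[C]_n).

Lemma eigen_colP M (a : C) :
  eigenvalue M a <-> exists2 w : 'cV[C]_n, w != 0 & M *m w = a *: w.
Proof.
have -> : eigenvalue M a = (M - a%:M \notin unitmx).
  by rewrite /eigenvalue /eigenspace kermx_eq0 row_free_unit.
have kerE w : ((M - a%:M) *m w = 0) <-> M *m w = a *: w.
  by rewrite mulmxBl mul_scalar_mx; split=> [/subr0_eq//|->]; rewrite subrr.
split=> [/unitmx_cVP nu|[w w0 /kerE h]].
  apply: contrapT => /forall2NP h; apply: nu => w /kerE Mw.
  by apply/eqP; have [/negP/negPn|] := h w.
by apply/unitmx_cVP => /(_ w h) wz; rewrite wz eqxx in w0.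
Qed.

Lemma sesq_BAB A B w : B^t* = B -> sesq (B *m A *m B) w w = sesq A (B *m w) (B *m w).
Proof. by move=> BB; rewrite -mulmxA sesq_mull BB sesq_mul. Qed.

(** If A B w = a w, then w^* B A B w = a w^* B w with both forms real. *)
Lemma eig_real A B (a : C) : A^t* = A -> pdmx B -> eigenvalue (A *m B) a ->
  complex.Im a = 0.
Proof.
move=> AA pB /eigen_colP[w w0 h].
have /pdmxP[BB Bpos] := pB.
have e : sesq (B *m A *m B) w w = a * sesq B w w.
  by rewrite -mulmxA sesq_mul h sesqZr.
have := congr1 (@complex.Im R) e; rewrite (sesq_BAB A w BB) herm_sesq_Im // cImM.
rewrite herm_sesq_Im // mulr0 add0r => /esym/eqP.
by rewrite mulf_eq0 (gt_eqF (Bpos _ w0)) orbF => /eqP.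
Qed.

Lemma eig_lt1_of_form A B (a : C) : A^t* = A -> pdmx B ->
  pdmx (B - B *m A *m B) -> eigenvalue (A *m B) a -> complex.Re a < 1.
Proof.
move=> AA pB pM ea; have ia := eig_real AA pB ea.
have /pdmxP[BB Bpos] := pB; have /pdmxP[_ Mpos] := pM.
move/eigen_colP: ea => [w w0 h].
have := Mpos _ w0; rewrite sesqMDl sesqMN -mulmxA sesq_mul h sesqZr cReD cReN cReM.
rewrite ia mul0r subr0 -{1}[complex.Re (sesq B w w)]mul1r -mulrBl.
by rewrite pmulr_lgt0 ?Bpos // subr_gt0.
Qed.

(** Composition with the clamp extends a path on [a, b] to the whole line, as
    [pd_path] requires. *)
Lemma clamp_itv (a b t : R) : a <= b -> a <= Num.max a (Num.min b t) <= b.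
Proof. by move=> ab; rewrite le_max lexx /= ge_max ab ge_min lexx. Qed.

Lemma clamp_cont (a b : R) : continuous (fun t : R => Num.max a (Num.min b t)).
Proof.
move=> t; apply: (@continuous_max R R (cst a) (fun t => Num.min b t)).
  exact: cvg_cst.
by apply: (@continuous_min R R (cst b) id); [exact: cvg_cst | exact: cvg_id].
Qed.

Lemma herm_BAB A B : A^t* = A -> B^t* = B -> (B *m A *m B)^t* = B *m A *m B.
Proof. by move=> AA BB; rewrite !adjM AA BB mulmxA. Qed.

Lemma adjB m p (M N : 'M[C]_(m, p)) : (M - N)^t* = M^t* - N^t*.
Proof. by rewrite linearB /= map_mxB. Qed.

Lemma adjZ_real m p (s : R) (M : 'M[C]_(m, p)) :
  (s%:C *: M)^t* = s%:C *: M^t*.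
Proof.
apply/matrixP => i j; rewrite !mxE; case: (M j i) => a b.
by apply: complex_eqP => /=; ring.
Qed.

(** The path s |-> B - s B A B joins B to the matrix of the conclusion; it is
    singular at s exactly when s A B fixes a nonzero vector. *)
Lemma form_of_nonsingular A B : A^t* = A -> pdmx B ->
  (forall (s : R) w, 0 <= s <= 1 -> s%:C *: (A *m B *m w) = w -> w = 0) ->
  pdmx (B - B *m A *m B).
Proof.
move=> AA pB ns; have /pdmxP[BB Bpos] := pB.
pose c (t : R) := Num.max 0 (Num.min 1 t).
pose H t := B - (c t)%:C *: (B *m A *m B).
have c0 : c 0 = 0 by rewrite /c min_r ?ler01 // maxxx.
have c1 : c 1 = 1 by rewrite /c minxx max_r.
have -> : B - B *m A *m B = H 1 by rewrite /H c1 scale1r.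
apply: (@pd_path R n H 0 1).
- move=> t; apply: mcvgB; first exact: mcvg_cst.
  apply: mcvgZ; last exact: mcvg_cst.
  by split; [exact: clamp_cont | exact: cvg_cst].
- by move=> t; rewrite /H adjB adjZ_real BB (herm_BAB AA BB).
- move=> t v Hv; apply: (ns (c t)); first exact: clamp_itv.
  apply/eqP; rewrite eq_sym -subr_eq0; apply/eqP; apply: (pd_inj pB).
  by rewrite -Hv /H mulmxBr mulmxBl -scalemxAr -scalemxAl !mulmxA.
- by rewrite /H c0 scale0r subr0.
Qed.

(** If s A B fixes w <> 0, then 1/s >= 1 is an eigenvalue of A B. *)
Lemma form_of_eig A B : A^t* = A -> pdmx B ->
  (forall a : C, eigenvalue (A *m B) a -> complex.Re a < 1) ->
  pdmx (B - B *m A *m B).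
Proof.
move=> AA pB eig; apply: form_of_nonsingular => // s w /andP[s0 s1] h.
apply/eqP/negP => /negP w0.
have sn0 : s != 0.
  by apply: contra w0 => /eqP s00; rewrite -h s00 scale0r.
have : complex.Re (s^-1)%:C < 1.
  apply: eig; apply/eigen_colP; exists w => //.
  by rewrite -{2}h scalerA -rmorphM mulVf // scale1r.
have sp : 0 < s by rewrite lt_def sn0.
by rewrite /= invf_lt1 // => /lt_le_trans/(_ s1); rewrite ltxx.
Qed.

Lemma form_of_small A B : A^t* = A -> pdmx B -> l1norm (A *m B) < 1 ->
  pdmx (B - B *m A *m B).
Proof.
move=> AA pB lt1; apply: form_of_nonsingular => // s w /andP[s0 s1] h.
apply/eqP; rewrite -l1norm_eq0 eq_le l1norm_ge0 andbT leNgt; apply/negP => w0.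
have : l1norm w <= l1norm (A *m B) * l1norm w.
  apply: le_trans (l1normM _ _); rewrite -{1}h.
  rewrite /l1norm; apply: ler_sum => i _; apply: ler_sum => j _.
  rewrite mxE normcM ler_piMl ?normc_ge0 //.
  by rewrite normc_sqrt /= expr0n addr0 sqrtr_sqr ger0_norm.
by rewrite leNgt gtr_pMl // lt1.
Qed.

(** The variational form of B^-1 >= B1^-1.  Let x = B w and z = B1^-1 x.  Expanding
    (w - z)^* B (w - z) >= 0 and using B <= B1 gives z^* B1 z <= w^* B w.  If
    A B w = w, then w^* B w = x^* A x <= x^* A1 x = z^* B1 A1 B1 z, so that the
    form of B1 - B1 A1 B1 at z is not positive. *)
Lemma nonsingular_mono A B A1 B1 w :
  pdmx B -> pdmx B1 ->
  (forall v, complex.Re (sesq A v v) <= complex.Re (sesq A1 v v)) ->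
  (forall v, complex.Re (sesq B v v) <= complex.Re (sesq B1 v v)) ->
  pdmx (B1 - B1 *m A1 *m B1) -> A *m B *m w = w -> w = 0.
Proof.
move=> pB pB1 leA leB pM h.
have /pdmxP[BB1 _] := pB1; have /pdmxP[BB Bpos] := pB; have /pdmxP[_ Mpos] := pM.
pose z := invmx B1 *m (B *m w).
have B1z : B1 *m z = B *m w by rewrite mulKVmx // pd_unit.
have e1 : sesq B w w = sesq A (B *m w) (B *m w).
  by rewrite -(sesq_BAB A w BB) -mulmxA sesq_mul h.
have le1 : complex.Re (sesq B1 z z) <= complex.Re (sesq B w w).
  have h0 : 0 <= complex.Re (sesq B (w - z) (w - z)).
    have [->|/Bpos/ltW//] := eqVneq (w - z) 0; by rewrite sesq0r.
  have zz : sesq B z w = sesq B1 z z by rewrite sesq_1 -B1z -sesq_1.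
  have zz' : sesq B w z = (sesq B1 z z)^*.
    by rewrite -zz sesqJ BB.
  move: h0 (leB z); rewrite !(sesqDl, sesqDr, sesqNl, sesqNr) zz zz'.
  rewrite !(cReD, cReN, cReJ).
  by move: (complex.Re _) (complex.Re _) (complex.Re _) => x y z'; clear; lra.
have le2 : complex.Re (sesq (B1 *m A1 *m B1) z z) >= complex.Re (sesq B1 z z).
  by rewrite (sesq_BAB A1 z BB1) B1z; apply: (le_trans le1); rewrite e1; exact: leA.
have z0 : z = 0.
  apply/eqP/negP => /negP/Mpos; rewrite sesqMDl sesqMN cReD cReN subr_gt0.
  move=> /lt_le_trans/(_ le2).
  by rewrite ltxx.
apply: (pd_inj pB); by rewrite -B1z z0 mulmx0.
Qed.

(** The spectrum is finite, being contained in the list of roots of the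
    characteristic polynomial, so a strict bound on its elements passes to the
    supremum. *)
Lemma largest_eigenvalue_lt1 M : (0 < n)%N ->
  has_real_spectrum M ->
  largest_eigenvalue M < 1 <-> (forall a : C, eigenvalue M a -> complex.Re a < 1).
Proof.
move=> n0 re; have reE a : eigenvalue M a -> a = (complex.Re a)%:C.
  by move/re => ar; rewrite RRe_real.
have [a0 ea0] := eigenvalue_closed M n0.
have [r rE] := closed_field_poly_normal (char_poly M).
have inr a : eigenvalue M a -> a \in r.
  rewrite eigenvalue_root_char rE rootZ ?root_prod_XsubC //.
  by rewrite lead_coef_eq0 monic_neq0 // char_poly_monic.
pose E := [set x : R | eigenvalue M x%:C].
have E0 : E !=set0 by exists (complex.Re a0); rewrite /E /= -reE.
have [b bE] : exists b, ubound E b.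
  exists (\sum_(a <- r) `|complex.Re a|) => x /= /inr xr.
  rewrite (big_rem _ xr) /=; apply: (le_trans (ler_norm _)).
  by rewrite lerDl sumr_ge0.
split=> [lt1 a ea|h].
  apply: le_lt_trans lt1; apply: (ub_le_sup (E := E)); first by exists b.
  by rewrite /E /= -reE.
have {b bE} [c c1 cE] : exists2 c, c < 1 & ubound E c.
  suff [d d1 hd] : exists2 d, d < 1 &
      forall a, a \in r -> complex.Re a < 1 -> complex.Re a <= d.
    by exists d => // x ex; apply: (hd x%:C); [exact: inr | exact: h ex].
  clear; elim: r => [|c r [d d1 hd]]; first by exists 0.
  have [c1|c1] := ltP (complex.Re c) 1; last first.
    exists d => // a; rewrite inE => /orP[/eqP ->|/hd//].
    by move=> /lt_le_trans/(_ c1); rewrite ltxx.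
  exists (Num.max (complex.Re c) d); first by rewrite gt_max c1.
  move=> a; rewrite inE => /orP[/eqP -> _|/hd{}hd /hd]; first by rewrite le_max lexx.
  by move=> ?; rewrite le_max; apply/orP; right.
exact: le_lt_trans (ge_sup E0 cE) c1.
Qed.

End Spectrum.

(** * Rational functions with nonnegative imaginary part on the half disc *)

Section HalfDisc.
Context {R : realType}.
Local Notation C := R[i].
Implicit Types (n g p q : {poly C}) (u w z : C).

Lemma ccvg_line (F : set_system R) {FF : Filter F} (u0 a : C) :
  id @ F --> (0 : R) -> ccvg F (fun t : R => u0 + t%:C * a) u0.
Proof.
move=> F0; rewrite -[X in ccvg _ _ X]addr0 -[X in _ + X](mul0r a).
apply: ccvgD; first exact: ccvg_cst.
by apply: ccvgM; [split; [exact: F0|exact: cvg_cst] | exact: ccvg_cst].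
Qed.

Lemma ccvg_line_right (u0 a : C) : ccvg (0^'+) (fun t : R => u0 + t%:C * a) u0.
Proof. by apply: ccvg_line; exact: cvg_within. Qed.

Lemma XsubC_factor p u : p != 0 -> exists k q,
  q.[u] != 0 /\ p = q * ('X - u%:P) ^+ k.
Proof.
move=> p0; have [k [q qu pE]] := multiplicity_XsubC p u.
by exists k, q; split => //; move: qu; rewrite p0.
Qed.

Lemma near_right_gt0 : \forall t \near (0 : R)^'+, 0 < t.
Proof. exact: nbhs_right_gt. Qed.

Lemma horner_line_neq0 p (u0 a : C) : p != 0 -> a != 0 ->
  \forall t \near (0 : R)^'+, p.[u0 + t%:C * a] != 0.
Proof.
move=> p0 a0; have [k [q [qu pE]]] := XsubC_factor u0 p0.
have qn := ccvg_neq0 qu (ccvg_horner q (ccvg_line_right u0 a)).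
near=> t; have qt : q.[u0 + t%:C * a] != 0 by near: t; exact: qn.
have t0 : 0 < t by near: t; exact: near_right_gt0.
 rewrite pE hornerM mulf_neq0 //.
rewrite horner_exp hornerXsubC addrAC subrr add0r expf_neq0 // mulf_neq0 //.
by rewrite fmorph_eq0 gt_eqF.
Unshelve. all: by end_near.
Qed.

Lemma ccvg_ratio (T : Type) (F : set_system T) {FF : Filter F} n g (f : T -> C) u :
  g.[u] != 0 -> ccvg F f u -> ccvg F (fun t => n.[f t] / g.[f t]) (n.[u] / g.[u]).
Proof.
move=> gu fu; apply: ccvgM; first exact: ccvg_horner.
by apply: ccvgV => //; exact: ccvg_horner.
Qed.

(** Near u0 the function n/g - c, with c its value at u0, behaves like a nonzero
    multiple of (u - u0)^k with k > 0 unless it vanishes.  In a suitable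
    direction, given by a k-th root, it is a negative multiple of i. *)
Lemma local_min_const n g u0 : g.[u0] != 0 ->
  (forall w, \forall t \near (0 : R)^'+, complex.Im (n.[u0] / g.[u0]) <=
     complex.Im (n.[u0 + t%:C * w] / g.[u0 + t%:C * w])) ->
  n = (n.[u0] / g.[u0]) *: g.
Proof.
set c := n.[u0] / g.[u0] => gu hmin.
apply/eqP/negP => /negP; rewrite -subr_eq0 => p0.
have [k [q [qu pE]]] := XsubC_factor u0 p0.
have k0 : (0 < k)%N.
  rewrite lt0n; apply: contra qu => /eqP k0.
  have := congr1 (horner^~ u0) pE; rewrite k0 expr0 mulr1 => <-.
  by rewrite hornerD hornerN hornerZ /c divfK // subrr.
(* In this direction q w^k / g is close to - i. *)
pose w := k.-root (- 'i%C * (g.[u0] / q.[u0])).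
have wk : w ^+ k = - 'i%C * (g.[u0] / q.[u0]) by rewrite /w rootCK.
pose L t : C := u0 + t%:C * w.
have lim : ccvg (0^'+) (fun t => (q.[L t] / g.[L t]) * (g.[u0] / q.[u0])) 1.
  rewrite -[X in ccvg _ _ X](_ : (q.[u0] / g.[u0]) * (g.[u0] / q.[u0]) = 1).
    apply: ccvgM; last exact: ccvg_cst.
    by apply: ccvg_ratio => //; exact: ccvg_line_right.
  by rewrite mulrA divfK // divff.
have near1 : \forall t \near (0 : R)^'+,
    0 < complex.Re ((q.[L t] / g.[L t]) * (g.[u0] / q.[u0])).
  exact: (@cvgr_gt R R _ _ _ _ (proj1 lim) _ (ltr01 : 0 < complex.Re (1 : C))).
have near2 : \forall t \near (0 : R)^'+, g.[L t] != 0.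
  exact: ccvg_neq0 gu (ccvg_horner g (ccvg_line_right u0 w)).
have [t [[b0 gt] [t0 le]]] :=
  filter_ex (filterI (filterI near1 near2) (filterI near_right_gt0 (hmin w))).
move: le; rewrite -/(L t).
have -> : n.[L t] / g.[L t] =
    c + (t ^+ k)%:C * (- 'i%C * ((q.[L t] / g.[L t]) * (g.[u0] / q.[u0]))).
  have nE : n.[L t] = c * g.[L t] + (n - c *: g).[L t].
    by rewrite hornerD hornerN hornerZ addrC subrK.
  rewrite nE mulrDl mulfK // pE hornerM horner_exp hornerXsubC /L.
  rewrite [u0 + _ - u0]addrAC subrr add0r exprMn wk rmorphXn /=.
  by congr (_ + _); ring.
rewrite cImD -subr_ge0 addrAC subrr add0r cImM /=.
set b := _ * (_ / _) in b0 *; case: b b0 => b1 b2 /= b0.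
have tk : 0 < t ^+ k := exprn_gt0 k t0.
rewrite (_ : _ + _ = - (t ^+ k * b1)); last by ring.
by rewrite oppr_ge0 leNgt mulr_gt0.
Qed.


(** Maximum principle.  Where Im (n/g) attains its minimum on the compact half
    disc, either the point is on the boundary and the minimum is nonnegative, or
    [local_min_const] makes n/g constant, which contradicts positivity at i. *)
Lemma half_disc_im_gt0 n g :
    (forall u, normc u <= 1 -> 0 <= complex.Im u -> g.[u] != 0) ->
    (forall u, normc u <= 1 -> complex.Im u = 0 ->
       0 <= complex.Im (n.[u] / g.[u])) ->
    (forall u, normc u = 1 -> 0 < complex.Im u ->
       0 < complex.Im (n.[u] / g.[u])) ->
  forall u, normc u < 1 -> 0 < complex.Im u -> 0 < complex.Im (n.[u] / g.[u]).
Proof.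
move=> g0 hreal harc u1 u1lt u1im; rewrite ltNge; apply/negP => hu1.
pose toC (p : R * R) : C := p.1 +i* p.2.
have toCc (p : R * R) : ccvg (nbhs p) toC (toC p).
  by split; [exact: cvg_fst | exact: cvg_snd].
pose f (p : R * R) := complex.Im (n.[toC p] / g.[toC p]).
pose K := (`[-1, 1]%classic `*` `[0, 1]%classic) `&`
  ((fun p : R * R => normc (toC p)) @^-1` [set x : R | x <= 1]).
have KP (p : R * R) : K p <-> normc (toC p) <= 1 /\ 0 <= p.2.
  split=> [[[_ /=]]|[h1 h2]].
    by rewrite in_itv /= => /andP[-> _].
  split=> //; split=> /=; rewrite in_itv /=.
    by rewrite -ler_norml; apply: le_trans h1; exact: (normc_ler_Re (toC p)).
  rewrite h2 /=; apply: le_trans h1; apply: le_trans (normc_ler_Im (toC p)).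
  exact: ler_norm.
have Kc : compact K.
  apply: compact_closedI.
    by apply: compact_setX; exact: segment_compact.
  apply: closed_comp; last exact: closed_le.
  by move=> p _; apply: ccvg_normc; exact: toCc.
have fc : {within K, continuous f}.
  apply: continuous_in_subspaceT => p; rewrite inE => /KP[p1 p2].
  by apply: (proj2 (ccvg_ratio n (g0 _ p1 p2) (toCc p))).
have K1 : K (complex.Re u1, complex.Im u1).
  by apply/KP; split; [move: u1lt; case: (u1) => a b /ltW | exact: ltW].
have [c cK cmin] := compact_EVT_min (ex_intro _ _ K1) Kc fc.
have hmin u : normc u <= 1 -> 0 <= complex.Im u ->
    f c <= complex.Im (n.[u] / g.[u]).
  case: u => a b h1 h2; apply: (cmin (a, b)); rewrite inE; exact/KP.
have {cK} [cn ci] : normc (toC c) <= 1 /\ 0 <= complex.Im (toC c).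
  by move: cK; rewrite inE => /KP.
have [u [un ui hu umin]] : exists u, [/\ normc u < 1, 0 < complex.Im u,
    complex.Im (n.[u] / g.[u]) <= 0 & forall v, normc v <= 1 -> 0 <= complex.Im v ->
    complex.Im (n.[u] / g.[u]) <= complex.Im (n.[v] / g.[v])].
  have [fc0|fc0] := ltP (f c) 0; last first.
    exists u1; split=> // v v1 v2; apply: le_trans (hmin _ v1 v2).
    exact: le_trans hu1 fc0.
  exists (toC c); split=> //; last exact: ltW.
    rewrite lt_def cn andbT eq_sym; apply/eqP => c1.
    move: ci; rewrite le_eqVlt => /orP[/eqP/esym|] ci.
      by have := hreal _ cn ci; rewrite leNgt => /negP.
    by have := harc _ c1 ci; rewrite ltNge ltW.
  rewrite lt_def ci andbT; apply/eqP => c0.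
  by have := hreal _ cn c0; rewrite leNgt => /negP.
have nE : n = (n.[u] / g.[u]) *: g.
  apply: local_min_const; first by apply: g0; rewrite ?ltW.
  move=> w; have lw := ccvg_line_right u w.
  have near1 : \forall t \near (0 : R)^'+, normc (u + t%:C * w) < 1.
    exact: (@cvgr_lt R R _ _ _ _ (ccvg_normc lw) _ un).
  have near2 : \forall t \near (0 : R)^'+, 0 < complex.Im (u + t%:C * w).
    exact: (@cvgr_gt R R _ _ _ _ (proj2 lw) _ ui).
  near=> t; apply: umin; apply: ltW; near: t; [exact: near1 | exact: near2].
have ni : normc ('i%C : C) = 1 by rewrite /= expr0n expr1n add0r sqrtr1.
have := harc 'i%C ni ltr01.
rewrite [X in X.[_]]nE hornerZ mulfK ?ltNge ?hu //.
by apply: g0; rewrite ?ni ?ler01.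
Unshelve. all: by end_near.
Qed.

Lemma normc_real_le1 (x : R) : (normc x%:C <= 1) = (-1 <= x <= 1).
Proof. by rewrite normc_sqrt /= expr0n addr0 sqrtr_sqr ler_norml. Qed.

Lemma normc_real_lt1 (x : R) : (normc x%:C < 1) = (-1 < x < 1).
Proof. by rewrite normc_sqrt /= expr0n addr0 sqrtr_sqr ltr_norml. Qed.

Lemma diff_quotient n g x : exists q : {poly C}, forall u, g.[x] != 0 -> g.[u] != 0 ->
  n.[u] / g.[u] - n.[x] / g.[x] = (u - x) * (q.[u] / g.[u]).
Proof.
have [gx0|gx] := eqVneq g.[x] 0; first by exists 0.
have /factor_theorem[q qE] : root (n - (n.[x] / g.[x]) *: g) x.
  by rewrite /root hornerD hornerN hornerZ divfK // subrr.
exists q => u _ gu; have := congr1 (horner^~ u) qE.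
rewrite hornerD hornerN hornerZ hornerM hornerXsubC => h.
by rewrite mulrA [(u - x) * _]mulrC -h mulrBl mulfK.
Qed.

Section Segment.
Variables (n g : {poly C}).
Hypothesis g_neq0 : forall x : R, -1 <= x <= 1 -> g.[x%:C] != 0.
Hypothesis h_real : forall x : R, -1 <= x <= 1 -> complex.Im (n.[x%:C] / g.[x%:C]) = 0.
Hypothesis h_im : forall u, normc u < 1 -> 0 < complex.Im u ->
  0 <= complex.Im (n.[u] / g.[u]).

Let f (x : R) := complex.Re (n.[x%:C] / g.[x%:C]).

(** Let q/g be the difference quotient of n/g at x.  The derivative is the value
    of q/g at x, and Im (n/g) = t Re (q/g) at x + i t shows that it is
    nonnegative. *)
Lemma segment_derive (x : R) : -1 < x < 1 ->
  exists2 d, 0 <= d & is_derive x 1 f d.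
Proof.
move=> xlt; have x1 : -1 <= x <= 1 by move: xlt => /andP[/ltW -> /ltW ->].
have gx := g_neq0 x1; have [q qE] := diff_quotient n g x%:C.
exists (complex.Re (q.[x%:C] / g.[x%:C])).
  rewrite leNgt; apply/negP => neg.
  have line := ccvg_line_right x%:C ('i%C : C).
  have n1 : \forall t \near (0 : R)^'+,
      complex.Re (q.[x%:C + t%:C * 'i%C] / g.[x%:C + t%:C * 'i%C]) < 0.
    exact: (@cvgr_lt R R _ _ _ _ (proj1 (ccvg_ratio q gx line)) _ neg).
  have n2 : \forall t \near (0 : R)^'+, g.[x%:C + t%:C * 'i%C] != 0.
    exact: ccvg_neq0 gx (ccvg_horner g line).
  have n3 : \forall t \near (0 : R)^'+, normc (x%:C + t%:C * 'i%C) < 1.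
    by apply: (@cvgr_lt R R _ _ _ _ (ccvg_normc line)); rewrite normc_real_lt1.
  have [t [[h1 h2] [h3 t0]]] :=
    filter_ex (filterI (filterI n1 n2) (filterI n3 near_right_gt0)).
  set u := x%:C + t%:C * 'i%C in h1 h2 h3.
  have ui : 0 < complex.Im u by rewrite /u /= mulr1 mul0r addr0 add0r.
  have hE : n.[u] / g.[u] = n.[x%:C] / g.[x%:C] + t%:C * 'i%C * (q.[u] / g.[u]).
    by rewrite -[LHS](subrK (n.[x%:C] / g.[x%:C])) qE // addrC /u addrAC subrr add0r.
  have := h_im h3 ui; rewrite hE cImD h_real // add0r.
  case: (_ / _) h1 => a b /= h1.
  rewrite leNgt => /negP; apply.
  rewrite (_ : _ + _ = t * a); last by ring.
  by rewrite pmulr_rlt0.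
have lim : (fun h : R => h^-1 *: (f (h *: (1 : R) + x) - f x)) @ 0^' -->
    complex.Re (q.[x%:C] / g.[x%:C]).
  have line : ccvg (0^') (fun t : R => x%:C + t%:C * 1) x%:C.
    by apply: ccvg_line; exact: cvg_within.
  apply: cvg_trans (proj1 (ccvg_ratio q gx line)).
  apply: near_eq_cvg.
  have n1 : \forall t \near (0 : R)^', t != 0 by exact: nbhs_dnbhs_neq.
  have n2 := ccvg_neq0 gx (ccvg_horner g line).
  near=> t.
  have t0 : t != 0 by near: t; exact: n1.
  have gt : g.[x%:C + t%:C * 1] != 0 by near: t; exact: n2.
  have E : (t *: (1 : R) + x)%:C = x%:C + t%:C * 1.
    by rewrite rmorphD rmorphM mulr1 addrC.
  rewrite /f E -cReN -cReD qE // [_ - x%:C]addrAC subrr add0r mulr1.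
  case: (_ / g.[_]) => c d; rewrite /= mul0r subr0 /GRing.scale /=.
  by rewrite mulKf.
split; [exact: (cvgP _ lim) | exact: cvg_lim].
Unshelve. all: by end_near.
Qed.

Lemma segment_ndecr (a b : R) : -1 <= a -> a <= b -> b <= 1 -> f a <= f b.
Proof.
move=> a1 ab b1; move: ab; rewrite le_eqVlt => /orP[/eqP ->//|ab].
have sub x : x \in `]a, b[ -> -1 < x < 1.
  by rewrite in_itv /= => /andP[ax xb]; rewrite (le_lt_trans a1 ax) (lt_le_trans xb b1).
pose df x := 'D_1 f x.
have fd x : x \in `]a, b[ -> is_derive x 1 f (df x).
  by move=> /sub /segment_derive[d _ [dx _]]; split.
have fc : {within `[a, b], continuous f}.
  apply: continuous_in_subspaceT => x; rewrite inE /= in_itv /= => /andP[ax xb].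
  have gx : g.[x%:C] != 0 by apply: g_neq0; rewrite (le_trans a1 ax) (le_trans xb b1).
  have idc : ccvg (nbhs x) (fun y : R => y%:C) x%:C.
    by split; [exact: cvg_id | exact: cvg_cst].
  exact: (proj1 (ccvg_ratio n gx idc)).
have [c cab fE] := MVT ab fd fc.
rewrite -subr_ge0 fE; apply: mulr_ge0; last by rewrite subr_ge0 ltW.
have [d d0 dE] := segment_derive (sub _ cab).
by rewrite /df; case: dE => _ ->.
Qed.

(** Otherwise n/g would be constant on [a, b], hence everywhere, with a real
    value; this contradicts strict positivity at i/2. *)
Lemma segment_incr (a b : R) :
  (forall u, normc u < 1 -> 0 < complex.Im u ->
     g.[u] != 0 /\ 0 < complex.Im (n.[u] / g.[u])) ->
  -1 <= a -> a < b -> b <= 1 -> f a < f b.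
Proof.
move=> hs a1 ab b1; rewrite lt_def (segment_ndecr a1 (ltW ab) b1) andbT.
apply/eqP => fab.
have cst x : a <= x -> x <= b -> n.[x%:C] / g.[x%:C] = (f a)%:C.
  move=> ax xb; apply: complex_eqP => /=; last first.
    by apply: h_real; rewrite (le_trans a1 ax) (le_trans xb b1).
  by apply/eqP; rewrite eq_le -{1}fab !segment_ndecr //
    ?(le_trans xb b1) ?(le_trans a1 ax).
have nE : n = (f a)%:C *: g.
  apply/eqP/negP => /negP; rewrite -subr_eq0 => p0.
  have near0 := horner_line_neq0 a%:C p0 (oner_neq0 C).
  have near1 : \forall t \near (0 : R)^'+, t < b - a.
    by apply: nbhs_right_lt; rewrite subr_gt0.
  have [t [h0 [h1 t0]]] := filter_ex (filterI near0 (filterI near1 near_right_gt0)).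
  move: h0; rewrite mulr1 -rmorphD /= => /eqP; apply.
  have ta : a <= a + t by rewrite lerDl ltW.
  have tb : a + t <= b by rewrite -lerBrDl ltW.
  rewrite hornerD hornerN hornerZ -(cst (a + t)) // divfK ?subrr //.
  by apply: g_neq0; rewrite (le_trans a1 ta) (le_trans tb b1).
have [] := hs (0 +i* 2^-1).
- rewrite /= expr0n add0r sqrtr_sqr ger0_norm ?invr_ge0 //.
  by rewrite invf_lt1 // ltr1n.
- by rewrite /= invr_gt0.
- by move=> gi; rewrite nE hornerZ mulfK // /= ltxx.
Qed.

End Segment.

End HalfDisc.

(** * Values of a rational function at 1/u *)

Section Rational.
Context {R : realType}.
Local Notation C := R[i].
Local Notation rc := (map_poly (real_complex R)).
Local Notation tofrac := (@FracField.tofrac {poly R}).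
Local Notation "x %:F" := (tofrac x).
Implicit Types (f h : {fraction {poly R}}) (p : {poly R}) (u : C).

Lemma repr_frac f : f * ((repr f).2)%:F = ((repr f).1)%:F.
Proof.
rewrite -{1}[f]reprK; set x := repr f; rewrite !piE.
apply/eqmodP; rewrite /= FracField.equivfE !numden_Ratio ?oner_eq0 ?mulr1
  ?denom_ratioP //.
by rewrite mulrC.
Qed.

Lemma repr_den_neq0 f : (repr f).2 != 0.
Proof. exact: denom_ratioP. Qed.

Lemma rat_gcd_neq0 f : gcdp (repr f).1 (repr f).2 != 0.
Proof. by rewrite gcdp_eq0 negb_and repr_den_neq0 orbT. Qed.

Lemma ratden_neq0 f : ratden f != 0.
Proof.
have := repr_den_neq0 f; apply: contra => /eqP d0.
by rewrite -(divpK (dvdp_gcdr (repr f).1 (repr f).2)) -/(ratden f) d0 mul0r.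
Qed.

Lemma ratE f : f * (ratden f)%:F = (ratnum f)%:F.
Proof.
have g0 : (gcdp (repr f).1 (repr f).2)%:F != 0 by rewrite tofrac_eq0 rat_gcd_neq0.
apply: (mulIf g0); rewrite -mulrA -!tofracM.
by rewrite (divpK (dvdp_gcdr _ _)) (divpK (dvdp_gcdl _ _)) repr_frac.
Qed.

Lemma rat_coprime f : coprimep (ratnum f) (ratden f).
Proof. by apply: coprimep_div_gcd; rewrite repr_den_neq0 orbT. Qed.

(** The polynomial u^k p(1/u), for p of degree at most k. *)
Definition revpoly (k : nat) p : {poly C} := rc (\poly_(i < k.+1) p`_(k - i)).

Lemma revpolyE k p u : (size p <= k.+1)%N -> u != 0 ->
  (revpoly k p).[u] = u ^+ k * (rc p).[u^-1].
Proof.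
move=> sp u0; rewrite /revpoly (@horner_coef_wide _ k.+1); last first.
  by rewrite size_map_poly size_poly.
rewrite (@horner_coef_wide _ k.+1 _ u^-1); last by rewrite size_map_poly.
rewrite mulr_sumr (reindex_inj rev_ord_inj) /=; apply: eq_bigr => i _.
have ik : (i <= k)%N by rewrite -ltnS.
rewrite !coef_map coef_poly subSS ltnS leq_subr subKn //.
rewrite mulrCA; congr (_ * _).
by rewrite exprVn -expfB_cond // (negbTE u0).
Qed.

Lemma revpoly0 k p : (revpoly k p).[0] = (p`_k)%:C.
Proof. by rewrite horner_coef0 coef_map coef_poly subn0. Qed.

(** The common degree by which numerator and denominator are reversed.  With this
    choice [denV f] vanishes at 0 exactly when f has a pole at infinity, and
    [numV f] and [denV f] have no common root. *)
Definition rdeg f := (maxn (size (ratnum f)) (size (ratden f))).-1.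
Definition numV f := revpoly (rdeg f) (ratnum f).
Definition denV f := revpoly (rdeg f) (ratden f).
(** The value of f at 1/u, including the value at infinity for u = 0. *)
Definition valV f u : C := (numV f).[u] / (denV f).[u].

Lemma rdegS f : (rdeg f).+1 = maxn (size (ratnum f)) (size (ratden f)).
Proof. by rewrite prednK // leq_max orbC lt0n size_poly_eq0 ratden_neq0. Qed.

Lemma size_num f : (size (ratnum f) <= (rdeg f).+1)%N.
Proof. by rewrite rdegS leq_maxl. Qed.

Lemma size_den f : (size (ratden f) <= (rdeg f).+1)%N.
Proof. by rewrite rdegS leq_maxr. Qed.

Lemma numVE f u : u != 0 -> (numV f).[u] = u ^+ rdeg f * (rc (ratnum f)).[u^-1].
Proof. by move=> u0; rewrite revpolyE ?size_num. Qed.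

Lemma denVE f u : u != 0 -> (denV f).[u] = u ^+ rdeg f * (rc (ratden f)).[u^-1].
Proof. by move=> u0; rewrite revpolyE ?size_den. Qed.

Lemma valVE f u : u != 0 -> valV f u = rateval f u^-1.
Proof.
move=> u0; rewrite /valV numVE // denVE // invfM mulrACA divff ?mul1r //.
by rewrite expf_neq0.
Qed.

Lemma denV_pole f u : u != 0 -> ((denV f).[u] == 0) = ratpole f u^-1.
Proof. by move=> u0; rewrite denVE // mulf_eq0 expf_eq0 (negbTE u0) andbF. Qed.

Lemma denV_proper f : ((denV f).[0] != 0) = ratproper f.
Proof.
rewrite revpoly0 fmorph_eq0 /ratproper; set d := ratden f; set n := ratnum f.
have d0 : d != 0 := ratden_neq0 f.
have [le|gt] := leqP (size n) (size d).
  have -> : rdeg f = (size d).-1 by rewrite /rdeg (maxn_idPr le).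
  by rewrite -lead_coefE lead_coef_eq0.
rewrite nth_default ?eqxx //.
by rewrite -ltnS rdegS (maxn_idPl (ltnW gt)).
Qed.

Lemma numV_denV f u : (denV f).[u] = 0 -> (numV f).[u] != 0.
Proof.
have [->|u0] := eqVneq u 0; last first.
  move/eqP; rewrite denV_pole // => pole; rewrite numVE // mulf_neq0 ?expf_neq0 //.
  apply: (@coprimep_root _ (rc (ratden f))) => //.
  by rewrite coprimep_map coprimep_sym rat_coprime.
move=> d0; have := denV_proper f; rewrite d0 eqxx => /esym/negbT.
rewrite -ltnNge => lt.
rewrite revpoly0 fmorph_eq0.
have -> : rdeg f = (size (ratnum f)).-1 by rewrite /rdeg (maxn_idPl (ltnW lt)).
rewrite -lead_coefE lead_coef_eq0 -size_poly_eq0.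
by apply: contraTN lt => /eqP ->.
Qed.

Lemma denV_neq0 f : denV f != 0.
Proof.
have d0 := ratden_neq0 f; pose s := (size (ratden f)).-1.
have sk : (s <= rdeg f)%N.
  by rewrite -ltnS prednK ?size_den // lt0n size_poly_eq0.
apply/eqP => /(congr1 (fun q : {poly C} => q`_(rdeg f - s))) /eqP.
rewrite coef_map coef_poly ltnS leq_subr subKn // coef0 fmorph_eq0.
by rewrite -lead_coefE lead_coef_eq0 (negbTE d0).
Qed.

Lemma rc_conj p u : (rc p).[u^*] = ((rc p).[u])^*.
Proof.
rewrite -(horner_map (@conjc R)) /= -map_poly_comp.
by congr (_.[_]); apply: eq_map_poly => x /=; exact/esym/conjc_real.
Qed.

Lemma valV_conj f u : valV f u^* = (valV f u)^*.
Proof.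
rewrite /valV /numV /denV /revpoly !rc_conj rmorphM; congr (_ * _).
exact/esym/conjc_inv.
Qed.

Lemma denV_conj f u : ((denV f).[u^*] == 0) = ((denV f).[u] == 0).
Proof. by rewrite /denV /revpoly rc_conj conjc_eq0. Qed.

(** Evaluation is a ring morphism only away from the poles of the functions
    involved.  An identity that holds for all but finitely many u is enough, since
    it can be used at points that tend to the one of interest. *)
Definition generic (S : C -> Prop) :=
  exists2 q : {poly C}, q != 0 & forall u, q.[u] != 0 -> S u.

Lemma generic_and (S T : C -> Prop) :
  generic S -> generic T -> generic (fun u => S u /\ T u).
Proof.
move=> [q q0 qS] [r r0 rT]; exists (q * r); first exact: mulf_neq0.
by move=> u; rewrite hornerM mulf_eq0 negb_or => /andP[/qS ? /rT ?].
Qed.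

Lemma generic_sub (S T : C -> Prop) : (forall u, S u -> T u) ->
  generic S -> generic T.
Proof. by move=> ST [q q0 qS]; exists q => // u /qS/ST. Qed.

Lemma generic_true (S : C -> Prop) : (forall u, S u) -> generic S.
Proof. by move=> hS; exists 1; rewrite ?oner_eq0. Qed.

Lemma generic_forall (I : finType) (S : I -> C -> Prop) :
  (forall i, generic (S i)) -> generic (fun u => forall i, S i u).
Proof.
move=> gS; apply: (@generic_sub (fun u => forall i, i \in enum I -> S i u)).
  by move=> u hu i; apply: hu; rewrite mem_enum.
elim: (enum I) => [|i s IH]; first exact: generic_true.
apply: generic_sub (generic_and (gS i) IH) => u [Si Ss] j.
by rewrite inE => /orP[/eqP -> //|/Ss].
Qed.

Lemma generic_line (S : C -> Prop) (u0 a : C) : generic S -> a != 0 ->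
  \forall t \near (0 : R)^'+, S (u0 + t%:C * a).
Proof.
move=> [q q0 qS] a0; have h := horner_line_neq0 u0 q0 a0.
by near=> t; apply: qS; near: t; exact: h.
Unshelve. all: by end_near.
Qed.

Lemma generic_den f : generic (fun u => u != 0 /\ (denV f).[u] != 0).
Proof.
apply: generic_and; last by exists (denV f) => //; exact: denV_neq0.
by exists 'X => [|u]; rewrite ?polyX_eq0 // hornerX.
Qed.

Lemma rc_valV f u : u != 0 -> (denV f).[u] != 0 ->
  (rc (ratden f)).[u^-1] != 0 /\
  valV f u = (rc (ratnum f)).[u^-1] / (rc (ratden f)).[u^-1].
Proof. by move=> u0; rewrite denV_pole // => d0; split=> //; rewrite valVE. Qed.

Lemma valV_of_frac f n d u : u != 0 -> (denV f).[u] != 0 ->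
  f * d%:F = n%:F -> (rc d).[u^-1] != 0 ->
  valV f u = (rc n).[u^-1] / (rc d).[u^-1].
Proof.
move=> u0 fu e du; have [fd ->] := rc_valV u0 fu.
have : ratnum f * d = n * ratden f.
  by apply/eqP; rewrite -tofrac_eq !tofracM -e -ratE mulrAC.
move=> /(congr1 (fun q => (rc q).[u^-1])); rewrite !rmorphM !hornerM /= => h.
by apply/eqP; rewrite eqr_div // h.
Qed.

Lemma valVD f h : generic (fun u => valV (f + h) u = valV f u + valV h u).
Proof.
apply: generic_sub (generic_and (generic_den (f + h))
  (generic_and (generic_den f) (generic_den h))) => u [[u0 su] [[_ fu] [_ hu]]].
have [fd fE] := rc_valV u0 fu; have [hd hE] := rc_valV u0 hu.
rewrite (@valV_of_frac _ (ratnum f * ratden h + ratnum h * ratden f)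
  (ratden f * ratden h) u) //.
- by rewrite fE hE addf_div // rmorphD !rmorphM !hornerE.
- rewrite tofracD !tofracM -!ratE; ring.
- by rewrite rmorphM hornerM mulf_neq0.
Qed.

Lemma valVM f h : generic (fun u => valV (f * h) u = valV f u * valV h u).
Proof.
apply: generic_sub (generic_and (generic_den (f * h))
  (generic_and (generic_den f) (generic_den h))) => u [[u0 su] [[_ fu] [_ hu]]].
have [fd fE] := rc_valV u0 fu; have [hd hE] := rc_valV u0 hu.
rewrite (@valV_of_frac _ (ratnum f * ratnum h) (ratden f * ratden h) u) //.
- by rewrite fE hE mulf_div !rmorphM !hornerE.
- rewrite !tofracM -!ratE; ring.
- by rewrite rmorphM hornerM mulf_neq0.
Qed.

Lemma valV0 : generic (fun u => valV 0 u = 0).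
Proof.
apply: generic_sub (generic_den 0) => u [u0 du].
rewrite (@valV_of_frac _ 0 1 u) // ?rmorph0 ?rmorph1 ?horner0 ?mul0r //.
by rewrite hornerC oner_eq0.
Qed.

Lemma valV1 : generic (fun u => valV 1 u = 1).
Proof.
apply: generic_sub (generic_den 1) => u [u0 du].
by rewrite (@valV_of_frac _ 1 1 u) // ?rmorph1 ?mulr1 // hornerC ?divr1 // oner_eq0.
Qed.

Lemma valVN f : generic (fun u => valV (- f) u = - valV f u).
Proof.
apply: generic_sub (generic_and (generic_and (valVD f (- f)) valV0) valV0) => u [[]].
by rewrite subrr => -> /eqP; rewrite addrC addr_eq0 => /eqP.
Qed.

Lemma valV_sum (I : Type) (r : seq I) (F : I -> {fraction {poly R}}) :
  generic (fun u => valV (\sum_(i <- r) F i) u = \sum_(i <- r) valV (F i) u).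
Proof.
elim: r => [|i r IH].
  by apply: generic_sub valV0 => u; rewrite !big_nil.
by apply: generic_sub (generic_and (valVD (F i) (\sum_(j <- r) F j)) IH) => u [];
  rewrite !big_cons => -> ->.
Qed.

(** If the reversed denominator vanished at u0, the reversed numerator would not,
    and the quotient would be unbounded along any line through u0. *)
Lemma valV_bounded f u0 a (K : R) : a != 0 ->
  (\forall t \near (0 : R)^'+, normc (valV f (u0 + t%:C * a)) <= K) ->
  (denV f).[u0] != 0.
Proof.
move=> a0 hK; apply/eqP => d0; have n0 := numV_denV d0.
pose L t : C := u0 + t%:C * a.
have line : ccvg (0^'+) L u0 := ccvg_line_right u0 a.
have dc : (fun t => normc (denV f).[L t]) @ 0^'+ --> normc (denV f).[u0].
  exact: ccvg_normc (ccvg_horner (denV f) line).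
have nc : (fun t => normc (numV f).[L t]) @ 0^'+ --> normc (numV f).[u0].
  exact: ccvg_normc (ccvg_horner (numV f) line).
have K0 : 0 < `|K| + 1 by rewrite ltr_wpDl.
have np : 0 < normc (numV f).[u0] by rewrite lt_def normc_ge0 normc_eq0 n0.
have nr : 0 < normc (numV f).[u0] / 2 / (`|K| + 1) by rewrite !divr_gt0.
have near1 : \forall t \near (0 : R)^'+,
    normc (denV f).[L t] < normc (numV f).[u0] / 2 / (`|K| + 1).
  by apply: (@cvgr_lt R R _ _ _ _ dc); rewrite d0 normc0.
have near2 : \forall t \near (0 : R)^'+, normc (numV f).[u0] / 2 < normc (numV f).[L t].
  by apply: (@cvgr_gt R R _ _ _ _ nc); rewrite ltr_pdivrMr // ltr_pMr // ltr1n.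
have near3 := horner_line_neq0 u0 (denV_neq0 f) a0.
have [t [[h1 h2] [h3 hk]]] :=
  filter_ex (filterI (filterI near1 near2) (filterI near3 hK)).
have : normc (numV f).[L t] <= (`|K| + 1) * normc (denV f).[L t].
  have -> : (numV f).[L t] = valV f (L t) * (denV f).[L t] by rewrite /valV divfK.
  rewrite normcM ler_wpM2r ?normc_ge0 //; apply: (le_trans hk).
  by apply: (le_trans (ler_norm _)); rewrite lerDl.
rewrite leNgt => /negP; apply; apply: lt_trans h2.
by rewrite mulrC -ltr_pdivlMr.
Qed.

End Rational.

(** * Transfer matrices at 1/u *)

Section TransferMatrices.
Context {R : realType}.
Local Notation C := R[i].
Local Notation F := {fraction {poly R}}.
Implicit Types (u : C).

Definition valVmx (p q : nat) (G : 'M[F]_(p, q)) u : 'M[C]_(p, q) :=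
  map_mx (valV^~ u) G.

(** No entry has a pole at 1/u, which is the point at infinity when u = 0. *)
Definition polefree (p q : nat) (G : 'M[F]_(p, q)) u :=
  forall i j, (denV (G i j)).[u] != 0.

Lemma valVmxM p q r (G : 'M[F]_(p, q)) (H : 'M[F]_(q, r)) :
  generic (fun u => valVmx (G *m H) u = valVmx G u *m valVmx H u).
Proof.
suff : generic (fun u => forall i k, valV ((G *m H) i k) u =
    \sum_j valV (G i j) u * valV (H j k) u).
  apply: generic_sub => u h; apply/matrixP => i k; rewrite [LHS]mxE h mxE.
  by apply: eq_bigr => j _; rewrite !mxE.
apply: generic_forall => i; apply: generic_forall => k.
have gM : generic (fun u => forall j,
    valV (G i j * H j k) u = valV (G i j) u * valV (H j k) u).
  by apply: generic_forall => j; exact: valVM.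
apply: generic_sub (generic_and gM
  (valV_sum (index_enum 'I_q) (fun j => G i j * H j k))).
by move=> u [h1 h2]; rewrite mxE h2; apply: eq_bigr => j _; rewrite h1.
Qed.

Lemma valVmxN p q (G : 'M[F]_(p, q)) : generic (fun u => valVmx (- G) u = - valVmx G u).
Proof.
suff : generic (fun u => forall i k, valV (- G i k) u = - valV (G i k) u).
  by apply: generic_sub => u h; apply/matrixP => i k; rewrite !mxE h.
by apply: generic_forall => i; apply: generic_forall => k; exact: valVN.
Qed.

Lemma valVmx1 p : generic (fun u => valVmx (1%:M : 'M[F]_p) u = 1%:M).
Proof.
apply: generic_sub (generic_and (@valV0 R) (@valV1 R)) => u [h0 h1].
by apply/matrixP => i k; rewrite !mxE; case: eqP.
Qed.

(** The value of [loop_mx] where P and Q have the values A and B. *)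
Definition loop_at m (A B : 'M[C]_m) : 'M[C]_(m + m) := block_mx 1%:M (- B) (- A) 1%:M.

Lemma valVmx_loop m (P Q : tfmx R m) :
  generic (fun u => valVmx (loop_mx P Q) u = loop_at (valVmx P u) (valVmx Q u)).
Proof.
apply: generic_sub (generic_and (valVmx1 m) (generic_and (valVmxN P) (valVmxN Q))).
move=> u [h1 [hP hQ]].
by rewrite /valVmx /loop_mx map_block_mx -!/(valVmx _ u) h1 hP hQ.
Qed.

Lemma valVmx_eval m (G : tfmx R m) u : u != 0 -> valVmx G u = tf_eval G u^-1.
Proof. by move=> u0; apply/matrixP => i j; rewrite !mxE valVE. Qed.

Lemma polefree_pole m (G : tfmx R m) u : u != 0 -> polefree G u <-> ~ tf_pole G u^-1.
Proof.
move=> u0; split=> [gG [i [j]]|nG i j].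
  by rewrite -denV_pole // (negbTE (gG i j)).
by apply/negP; rewrite denV_pole // => h; apply: nG; exists i, j.
Qed.

Lemma polefree_proper m (G : tfmx R m) : polefree G 0 <-> tf_proper G.
Proof. by split=> h i j; have := h i j; rewrite denV_proper. Qed.

Lemma valVmx_conj m (G : tfmx R m) u : tf_symmetric G -> (valVmx G u)^t* = valVmx G u^*.
Proof.
move=> sG; apply/matrixP => i j; rewrite !mxE valV_conj.
by have /matrixP/(_ i j) := sG; rewrite mxE => <-.
Qed.

Lemma valVmx_real m (G : tfmx R m) (x : R) : tf_symmetric G ->
  (valVmx G x%:C)^t* = valVmx G x%:C.
Proof. by move=> sG; rewrite valVmx_conj //; congr valVmx; exact: conjc_real. Qed.

Lemma valVmx_cvg (T : Type) (S : set_system T) {FS : Filter S} p q (G : 'M[F]_(p, q))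
    (f : T -> C) u :
  polefree G u -> ccvg S f u -> mcvg S (fun t => valVmx G (f t)) (valVmx G u).
Proof.
move=> gG fu i j; rewrite mxE; under eq_fun do rewrite mxE.
exact: ccvg_ratio (gG i j) fu.
Qed.

(** A single denominator serves all vectors v, because the form is a linear
    combination of the entries. *)
Lemma valVmx_form m (G : tfmx R m) : exists2 g : {poly C},
  (forall u, polefree G u <-> g.[u] != 0) &
  forall v : 'cV[C]_m, exists n : {poly C}, forall u, polefree G u ->
    sesq (valVmx G u) v v = n.[u] / g.[u].
Proof.
pose g : {poly C} := \prod_i \prod_j denV (G i j).
have gE u : polefree G u <-> g.[u] != 0.
  rewrite horner_prod; split=> [gG|/prodf_neq0 h i j].
    apply/prodf_neq0 => i _; rewrite horner_prod; apply/prodf_neq0 => j _; exact: gG.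
  by have := h i isT; rewrite horner_prod => /prodf_neq0/(_ j isT).
exists g => // v.
pose rep (h : C -> C) := exists n : {poly C},
  forall u, polefree G u -> h u = n.[u] / g.[u].
have repD h1 h2 : rep h1 -> rep h2 -> rep (fun u => h1 u + h2 u).
  move=> [n1 e1] [n2 e2]; exists (n1 + n2) => u gu.
  by rewrite e1 // e2 // hornerD mulrDl.
have repS (h : 'I_m -> C -> C) : (forall i, rep (h i)) -> rep (fun u => \sum_i h i u).
  move=> rh; elim: (index_enum _) => [|i s IH].
    by exists 0 => u _; rewrite big_nil horner0 mul0r.
  have [n e] := repD _ _ (rh i) IH.
  by exists n => u gu; rewrite big_cons e.
rewrite -/(rep _).
have -> : (fun u => sesq (valVmx G u) v v) =
    (fun u => \sum_j \sum_i (v i 0)^* * valV (G i j) u * v j 0).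
  apply/funext => u; rewrite /sesq mxE; apply: eq_bigr => j _.
  by rewrite mxE mulr_suml; apply: eq_bigr => i _; rewrite !mxE.
apply: (repS (fun j u => \sum_i (v i 0)^* * valV (G i j) u * v j 0)) => j.
apply: (repS (fun i u => (v i 0)^* * valV (G i j) u * v j 0)) => i.
have [q qE] : exists q, g = denV (G i j) * q.
  by rewrite /g (bigD1 i) //= (bigD1 j) //= -mulrA; eexists.
exists (((v i 0)^* * v j 0) *: (numV (G i j) * q)) => u gu.
have := gu; rewrite gE qE !hornerM mulf_eq0 negb_or => /andP[d0 q0].
by rewrite hornerZ !hornerM /valV; field; rewrite d0 q0.
Qed.

End TransferMatrices.

(** * The energy estimate *)

Section Energy.
Context {R : realType} {m : nat}.
Local Notation C := R[i].
Implicit Types (A B : 'M[C]_m) (e w : 'cV[C]_m).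

Lemma Im_sesq_skew A v :
  complex.Re (sesq ('i%C *: (A - A^t*)) v v) = - (2 * complex.Im (sesq A v v)).
Proof.
rewrite sesqMZ sesqMDl sesqMN -sesqJ; case: (sesq A v v) => a b /=; ring.
Qed.

Lemma skew_herm A : ('i%C *: (A - A^t*))^t* = 'i%C *: (A - A^t*).
Proof.
rewrite linearZ /= map_mxZ adjB adjK.
transitivity (- 'i%C *: (A^t* - A)).
  by congr (_ *: _); apply: complex_eqP; rewrite /= ?oppr0.
by rewrite scaleNr -scalerN opprB.
Qed.

Lemma pd_skew A : (forall v, v != 0 -> 0 < complex.Im (sesq A v v)) ->
  pdmx (- ('i%C *: (A - A^t*))).
Proof.
move=> h; apply/pdmxP; split=> [|v /h v0].
  by rewrite linearN /= map_mxN skew_herm.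
by rewrite sesqMN cReN Im_sesq_skew opprK mulr_gt0.
Qed.

(** Im (v^* A v) is half the form of the Hermitian matrix - i (A - A^* ). *)
Lemma Im_sesq_coercive A : (forall v, v != 0 -> 0 < complex.Im (sesq A v v)) ->
  exists2 d : R, 0 < d & forall v, d * l1norm v ^+ 2 <= complex.Im (sesq A v v).
Proof.
move=> /pd_skew/pd_coercive[d d0 h]; exists (d / 2); first by rewrite divr_gt0.
move=> v; have := h v; rewrite sesqMN cReN Im_sesq_skew opprK.
by rewrite mulrAC ler_pdivrMr // [_ * 2]mulrC.
Qed.

(** The imaginary parts of e1^* e2 and e2^* e1 cancel.  What remains of the sum of
    Im (e1^* A e1) and Im (e2^* B e2) is the energy supplied by w1 and w2. *)
Lemma energy_balance A B e1 e2 w1 w2 (d : R) :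
  (forall v, 0 <= complex.Im (sesq A v v)) ->
  (forall v, d * l1norm v ^+ 2 <= complex.Im (sesq B v v)) ->
  e1 - B *m e2 = w1 -> e2 - A *m e1 = w2 ->
  d * l1norm e2 ^+ 2 <= l1norm e1 * l1norm w2 + l1norm e2 * l1norm w1.
Proof.
move=> hA hB E1 E2.
have eB : sesq B e2 e2 = sesq 1%:M e2 e1 - sesq 1%:M e2 w1.
  by rewrite sesq_1 -sesqNr -sesqDr -E1 opprB addrC subrK.
have eA : sesq A e1 e1 = sesq 1%:M e1 e2 - sesq 1%:M e1 w2.
  by rewrite sesq_1 -sesqNr -sesqDr -E2 opprB addrC subrK.
have bnd (u v : 'cV[C]_m) : - complex.Im (sesq 1%:M u v) <= l1norm u * l1norm v.
  apply: (le_trans (normc_geNIm _)).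
  rewrite /sesq mulmx1; apply: (le_trans (normc_le_l1norm _ _ _)).
  by apply: (le_trans (l1normM _ _)); rewrite l1norm_adj.
have sym : complex.Im (sesq 1%:M e1 e2) = - complex.Im (sesq 1%:M e2 e1).
  by rewrite -cImJ sesqJ trmx1 map_mx1.
have := hA e1; have := hB e2; have := bnd e1 w2; have := bnd e2 w1.
rewrite eA eB !cImD !cImN sym; set a := complex.Im _; set b := complex.Im _.
set c := complex.Im _.
by move: (l1norm e1 * _) (l1norm e2 * _) (d * _) => x y z; clear; lra.
Qed.

Lemma loop_atE A B e1 e2 w1 w2 : loop_at A B *m col_mx e1 e2 = col_mx w1 w2 ->
  e1 - B *m e2 = w1 /\ e2 - A *m e1 = w2.
Proof.
rewrite /loop_at mul_block_col !mul1mx !mulNmx => /eq_col_mx[<- <-].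
by split=> //; rewrite addrC.
Qed.

(** With y = |e2|, the balance and |e1| <= 1 + b y give d y^2 <= 1 + (b + 1) y,
    hence y <= (b + 2) / d as soon as y > 1. *)
Lemma energy_bound A B (d b : R) : 0 < d ->
  (forall v, 0 <= complex.Im (sesq A v v)) ->
  (forall v, d * l1norm v ^+ 2 <= complex.Im (sesq B v v)) ->
  l1norm B <= b ->
  forall e1 e2 w1 w2, l1norm w1 <= 1 -> l1norm w2 <= 1 ->
  loop_at A B *m col_mx e1 e2 = col_mx w1 w2 ->
  l1norm e1 <= 1 + b * (1 + (b + 2) / d) /\ l1norm e2 <= 1 + (b + 2) / d.
Proof.
move=> d0 hA hB Bb e1 e2 w1 w2 w1b w2b /loop_atE[E1 E2].
have b0 : 0 <= b := le_trans (l1norm_ge0 B) Bb.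
have e1b : l1norm e1 <= 1 + b * l1norm e2.
  have -> : e1 = w1 + B *m e2 by rewrite -E1 subrK.
  apply: (le_trans (l1normD _ _)); apply: lerD => //.
  by apply: (le_trans (l1normM _ _)); rewrite ler_wpM2r ?l1norm_ge0.
have e2b : l1norm e2 <= 1 + (b + 2) / d.
  have q0 : 0 <= (b + 2) / d by rewrite divr_ge0 ?addr_ge0 // ltW.
  have [le1|gt1] := leP (l1norm e2) 1; first by apply: (le_trans le1); rewrite lerDl.
  apply: (@le_trans _ _ ((b + 2) / d)); last by rewrite lerDr.
  rewrite ler_pdivlMr //.
  have h := energy_balance hA hB E1 E2.
  have y0 : 0 < l1norm e2 := lt_trans ltr01 gt1.
  rewrite -(ler_pM2r y0).
  have x1 : l1norm e1 * l1norm w2 <= l1norm e1 by rewrite ler_piMr ?l1norm_ge0.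
  have y1 : l1norm e2 * l1norm w1 <= l1norm e2 by rewrite ler_piMr ?l1norm_ge0.
  move: h x1 y1 e1b gt1; clear.
  move: (l1norm e1) (l1norm e2) (_ * l1norm w2) (_ * l1norm w1) => x y p q; nra.
split=> //; apply: (le_trans e1b); rewrite lerD2l ler_wpM2l //.
Qed.

Lemma energy_inj A B (d : R) : 0 < d ->
  (forall v, 0 <= complex.Im (sesq A v v)) ->
  (forall v, d * l1norm v ^+ 2 <= complex.Im (sesq B v v)) ->
  forall e : 'cV[C]_(m + m), loop_at A B *m e = 0 -> e = 0.
Proof.
move=> d0 hA hB e; rewrite -[e]vsubmxK -{1}[0]col_mx0.
set e1 := usubmx e; set e2 := dsubmx e => /loop_atE[E1 E2].
have l1norm0 : l1norm (0 : 'cV[C]_m) = 0 by apply/eqP; rewrite l1norm_eq0.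
have := energy_balance hA hB E1 E2; rewrite l1norm0 !mulr0 addr0 => h.
have e20 : e2 = 0.
  apply/eqP; rewrite -l1norm_eq0 -sqrf_eq0 eq_le sqr_ge0 andbT.
  by rewrite -(pmulr_rle0 _ d0).
by move: E1; rewrite e20 mulmx0 subr0 => ->; rewrite col_mx0.
Qed.

Definition inverse_bound (d b : R) : R :=
  (1 + b * (1 + (b + 2) / d)) + (1 + (b + 2) / d).

Lemma energy_inverse A B (d b : R) (X : 'M[C]_(m + m)) : 0 < d ->
  (forall v, 0 <= complex.Im (sesq A v v)) ->
  (forall v, d * l1norm v ^+ 2 <= complex.Im (sesq B v v)) ->
  l1norm B <= b -> loop_at A B *m X = 1%:M ->
  forall i j, normc (X i j) <= inverse_bound d b.
Proof.
move=> d0 hA hB Bb LX i j.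
have b0 : 0 <= b := le_trans (l1norm_ge0 _) Bb.
have k0 : 0 <= 1 + (b + 2) / d.
  by rewrite addr_ge0 //; apply: divr_ge0; [exact: addr_ge0 | exact: ltW].
pose w := col j (1%:M : 'M[C]_(m + m)); pose e := col j X.
have LE : loop_at A B *m col_mx (usubmx e) (dsubmx e) =
    col_mx (usubmx w) (dsubmx w).
  rewrite !vsubmxK /e /w -LX; apply/matrixP => k l; rewrite !mxE.
  by apply: eq_bigr => q _; rewrite !mxE.
have wsum : l1norm (usubmx w) + l1norm (dsubmx w) = 1.
  rewrite -l1norm_col vsubmxK /l1norm; under eq_bigr do rewrite big_ord1 !mxE.
  rewrite (bigD1 j) //= eqxx normc1 big1 ?addr0 // => k kj.
  by rewrite (negbTE kj) normc0.
have w1 : l1norm (usubmx w) <= 1 by rewrite -wsum lerDl l1norm_ge0.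
have w2 : l1norm (dsubmx w) <= 1 by rewrite -wsum lerDr l1norm_ge0.
have [e1b e2b] := energy_bound d0 hA hB Bb w1 w2 LE.
have -> : X i j = e i 0 by rewrite mxE.
rewrite /inverse_bound -[e]vsubmxK -(fintype.splitK i).
case: (fintype.split i) => i' /=.
  rewrite col_mxEu; apply: (le_trans (normc_le_l1norm _ _ _)).
  by apply: (le_trans e1b); rewrite lerDl.
rewrite col_mxEd; apply: (le_trans (normc_le_l1norm _ _ _)).
by apply: (le_trans e2b); rewrite lerDr addr_ge0 // mulr_ge0.
Qed.

End Energy.

(** * Poles of the closed loop *)

Section ClosedLoop.
Context {R : realType} {m : nat}.
Local Notation C := R[i].
Variables P Q : tfmx R m.
Implicit Types (u a : C).

Let L u := loop_at (valVmx P u) (valVmx Q u).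

Lemma loop_at_injP (A B : 'M[C]_m) :
  (forall w : 'cV_m, A *m B *m w = w -> w = 0) <->
  (forall e : 'cV_(m + m), loop_at A B *m e = 0 -> e = 0).
Proof.
split=> inj.
  move=> e; rewrite -[e]vsubmxK -{1}[0]col_mx0 => /loop_atE[].
  set e1 := usubmx e; set e2 := dsubmx e => /subr0_eq h1 /subr0_eq h2.
  have e20 : e2 = 0 by apply: inj; rewrite -mulmxA -h1 -h2.
  by rewrite h1 e20 mulmx0 col_mx0.
move=> w h; have := inj (col_mx (B *m w) w).
rewrite /loop_at mul_block_col !mul1mx !mulNmx subrr mulmxA h addrC subrr col_mx0.
by move=> /(_ erefl)/eqP; rewrite col_mx_eq0 => /andP[_ /eqP].
Qed.

Lemma loop_at_cvg (T : Type) (S : set_system T) {FS : Filter S} (f : T -> C) u :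
  polefree P u -> polefree Q u -> ccvg S f u -> mcvg S (fun t => L (f t)) (L u).
Proof.
move=> gP gQ fu i j; have cP := valVmx_cvg gP fu; have cQ := valVmx_cvg gQ fu.
rewrite -(fintype.splitK i) -(fintype.splitK j).
case: (fintype.split i) => i'; case: (fintype.split j) => j' /=.
- by rewrite block_mxEul; under eq_fun do rewrite block_mxEul; exact: ccvg_cst.
- rewrite block_mxEur mxE; under eq_fun do rewrite block_mxEur mxE.
  by apply: ccvgN; exact: cQ.
- rewrite block_mxEdl mxE; under eq_fun do rewrite block_mxEdl mxE.
  by apply: ccvgN; exact: cP.
- by rewrite block_mxEdr; under eq_fun do rewrite block_mxEdr; exact: ccvg_cst.
Qed.

(** If [loop_mx] were singular over the field of rational functions, a nonzero
    row vector over this field would annihilate it, and so would its value at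
    all but finitely many points. *)
Lemma loop_unit u0 a : a != 0 ->
  (\forall t \near (0 : R)^'+,
     forall e : 'cV_(m + m), L (u0 + t%:C * a) *m e = 0 -> e = 0) ->
  loop_mx P Q \in unitmx.
Proof.
move=> a0 inj; apply: contraT; rewrite -row_free_unit -kermx_eq0.
move=> /rowV0Pn[v /sub_kermxP vL v0].
have [j vj] : exists j, v 0 j != 0.
  apply: contrapT => /forallNP h; move/eqP: v0; apply.
  by apply/matrixP => i j; rewrite ord1 mxE; apply/eqP/negPn/negP/h.
have gv : generic (fun u => valV (v 0 j) u != 0).
  apply: generic_sub (generic_and (valVM (v 0 j) (v 0 j)^-1) (@valV1 R)) => u [].
  rewrite divff // => -> /eqP; apply: contraTneq => ->.
  by rewrite mul0r eq_sym oner_eq0.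
have g0 : generic (fun u => valVmx (0 : 'rV_(m + m)) u = 0).
  apply: generic_sub (@valV0 R) => u h.
  by apply/matrixP => i k; rewrite !mxE.
have gvL := valVmxM v (loop_mx P Q); rewrite vL in gvL.
have g := generic_and (generic_and gv g0) (generic_and gvL (valVmx_loop P Q)).
have [t [inj_t [[vt zt] [vLt Lt]]]] := filter_ex (filterI inj (generic_line u0 g a0)).
have Lu : L (u0 + t%:C * a) \in unitmx by apply/unitmx_cVP.
move: vLt; rewrite zt Lt => /esym /(congr1 (mulmx^~ (invmx (L (u0 + t%:C * a))))).
rewrite mulmxK // mul0mx => /matrixP/(_ 0 j); rewrite !mxE => h.
by rewrite h eqxx in vt.
Qed.

(** For all but finitely many u the value of the closed loop is an inverse of the
    loop matrix at u, so that [valV_bounded] applies to its entries. *)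
Lemma closed_loop_polefree u0 a (K : R) : loop_mx P Q \in unitmx -> a != 0 ->
  (\forall t \near (0 : R)^'+, forall X, L (u0 + t%:C * a) *m X = 1%:M ->
     forall i j, normc (X i j) <= K) ->
  polefree (closed_loop P Q) u0.
Proof.
move=> Lu a0 bnd i j; apply: (valV_bounded (K := K) a0).
have gM := valVmxM (loop_mx P Q) (closed_loop P Q).
rewrite /closed_loop mulmxV // in gM.
have g := generic_and (generic_and gM (valVmx1 (m + m))) (valVmx_loop P Q).
apply: filterS (filterI bnd (generic_line u0 g a0)) => t [bt [[gt one] lt]].
have := bt (valVmx (closed_loop P Q) (u0 + t%:C * a)) _ i j.
by rewrite mxE; apply; rewrite /L -lt -gt one.
Qed.

(** Matrices close to an invertible one have uniformly bounded inverses. *)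
Lemma regular_bound u0 a : polefree P u0 -> polefree Q u0 ->
  (forall e : 'cV_(m + m), L u0 *m e = 0 -> e = 0) ->
  exists K : R, \forall t \near (0 : R)^'+, forall X, L (u0 + t%:C * a) *m X = 1%:M ->
     forall i j, normc (X i j) <= K.
Proof.
move=> gP gQ /unitmx_cVP Lu.
pose k := l1norm (invmx (L u0)) + 1.
have k0 : 0 < k by rewrite ltr_wpDl ?l1norm_ge0.
(* The perturbation is kept so small that it absorbs half of the norm of X. *)
exists (2 * (k * l1norm (1%:M : 'M[C]_(m + m)))).
have k2 : 0 < (2 * k)^-1 by rewrite invr_gt0 mulr_gt0.
have nearL : \forall t \near (0 : R)^'+, l1norm (L (u0 + t%:C * a) - L u0) < (2 * k)^-1.
  exact: mcvg_l1norm (loop_at_cvg gP gQ (ccvg_line_right u0 a)) _ k2.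
apply: filterS nearL => t lt X LX i j; apply: (le_trans (normc_le_l1norm _ _ _)).
have XE : X = invmx (L u0) *m (1%:M - (L (u0 + t%:C * a) - L u0) *m X).
  by rewrite mulmxBl LX opprB addrC subrK mulKmx.
have h1 : l1norm X <= k * (l1norm (1%:M : 'M[C]_(m + m)) + (2 * k)^-1 * l1norm X).
  rewrite {1}XE; apply: (le_trans (l1normM _ _)); apply: ler_pM; rewrite ?l1norm_ge0 //.
    by rewrite lerDl.
  apply: (le_trans (l1normD _ _)); rewrite lerD2l l1normN.
  by apply: (le_trans (l1normM _ _)); rewrite ler_wpM2r ?l1norm_ge0 // ltW.
have h2 : k * ((2 * k)^-1 * l1norm X) = l1norm X / 2 by field; rewrite gt_eqF.
have h3 : l1norm X - l1norm X / 2 = l1norm X / 2 by field.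
move: h1; rewrite mulrDr h2 -lerBlDr h3.
by rewrite ler_pdivrMr // mulrC.
Qed.

End ClosedLoop.

(** * Negative imaginary transfer matrices *)

Section NegativeImaginary.
Context {R : realType} {m : nat}.
Local Notation C := R[i].
Implicit Types (G : tfmx R m) (u : C) (v : 'cV[C]_m).

Lemma normr_gt1 (z : C) : (1 < `|z|) = (1 < normc z).
Proof. by rewrite normr_normc -[1]/((1 : R)%:C) ltcR. Qed.

Lemma normr_lt1 (z : C) : (`|z| < 1) = (normc z < 1).
Proof. by rewrite normr_normc -[1]/((1 : R)%:C) ltcR. Qed.

Lemma normc_inv_gt1 u : u != 0 -> (1 < normc u^-1) = (normc u < 1).
Proof. by rewrite -normc_eq0 => u0; rewrite normcV invf_gt1 // lt_def u0 normc_ge0. Qed.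

Lemma Im_inv_lt0 u : 0 < complex.Im u -> complex.Im u^-1 < 0.
Proof.
move=> ui; rewrite cImV oppr_lt0 divr_gt0 //.
by rewrite ltr_wpDl ?sqr_ge0 ?exprn_gt0.
Qed.

Lemma Im_gt0_neq0 u : 0 < complex.Im u -> u != 0.
Proof. by move=> ui; apply: contraTneq ui => ->; rewrite ltxx. Qed.

Lemma DNI_polefree G u : D_NI G -> tf_proper G -> normc u < 1 -> polefree G u.
Proof.
move=> [np _] pG ult; have [->|u0] := eqVneq u 0; first exact/polefree_proper.
by apply/polefree_pole => //; apply: np; rewrite normr_gt1 normc_inv_gt1.
Qed.

Lemma DNI_Im G u v : D_NI G -> normc u < 1 -> 0 < complex.Im u ->
  0 <= complex.Im (sesq (valVmx G u) v v).
Proof.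
move=> [_ ni] ult ui; have u0 := Im_gt0_neq0 ui.
have := ni u^-1; rewrite normr_gt1 normc_inv_gt1 //.
move=> /(_ ult)[_ _ /(_ (Im_inv_lt0 ui))].
move=> /psdmxP[_ /(_ v)]; rewrite sesqMN cReN /tf_imag -valVmx_eval //.
by rewrite Im_sesq_skew opprK pmulr_rge0.
Qed.

Lemma DWSNI_polefree G u : D_WSNI G -> normc u <= 1 -> polefree G u.
Proof.
move=> [pG st _] ule; have [->|u0] := eqVneq u 0; first exact/polefree_proper.
apply/polefree_pole => // /st; rewrite normr_lt1 normcV; apply/negP; rewrite -leNgt.
by rewrite invf_ge1 // lt_def normc_eq0 u0 normc_ge0.
Qed.

(** On the unit circle 1/u is the conjugate of u, so the value of G at u is the
    adjoint of its value at 1/u: the sign of the imaginary part changes. *)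
Lemma DWSNI_arc G u v : D_WSNI G -> tf_symmetric G ->
  normc u = 1 -> 0 < complex.Im u -> v != 0 ->
  0 < complex.Im (sesq (valVmx G u) v v).
Proof.
move=> [_ _ sn] sG u1 ui v0.
have sq1 : complex.Re u ^+ 2 + complex.Im u ^+ 2 = 1.
  by rewrite -normc_sqr u1 expr1n.
have i2 : 0 < complex.Im u ^+ 2 by rewrite exprn_gt0.
have re1 : -1 < complex.Re u < 1.
  rewrite -ltr_norml -(@expr_lt1 _ 2) // real_normK ?num_real //.
  by rewrite -sq1 ltrDl.
have re1' : -1 <= complex.Re u <= 1 by move: re1 => /andP[/ltW -> /ltW ->].
have [re_gt re_lt] := andP re1.
have uE : u = cos (acos (complex.Re u)) +i* sin (acos (complex.Re u)).
  apply: complex_eqP => /=; first by rewrite acosK // in_itv.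
  by rewrite sin_acos // -sq1 addrAC subrr add0r sqrtr_sqr ger0_norm // ltW.
have th : 0 < acos (complex.Re u) < pi.
  by apply/andP; split; [apply: acos_gt0 | apply: acos_ltpi]; rewrite ?re_gt ?re_lt ltW.
have := sn _ th; rewrite -uE => /pdmxP[_ /(_ v v0)].
have E : tf_eval G u = (valVmx G u)^t*.
  rewrite valVmx_conj // valVmx_eval ?conjc_eq0 ?Im_gt0_neq0 //; congr tf_eval.
  rewrite -[LHS]invrK; congr (_^-1); apply: (mulfI (Im_gt0_neq0 ui)).
  rewrite divff ?Im_gt0_neq0 //; apply: complex_eqP; rewrite ?cReM ?cImM cReJ cImJ /=.
    by rewrite -sq1; ring.
  by ring.
rewrite /tf_imag E Im_sesq_skew -sesqJ cImJ mulrN opprK.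
by rewrite pmulr_rgt0.
Qed.

Lemma DWSNI_Im G u v : D_WSNI G -> tf_symmetric G ->
  normc u <= 1 -> 0 < complex.Im u -> v != 0 ->
  0 < complex.Im (sesq (valVmx G u) v v).
Proof.
move=> wG sG; rewrite le_eqVlt => /orP[/eqP u1 ui v0|]; first exact: DWSNI_arc.
move=> ult ui v0; have [g gE /(_ v)[n nE]] := valVmx_form G.
rewrite nE; last by apply: DWSNI_polefree => //; exact: ltW.
apply: half_disc_im_gt0 ult ui => z.
- by move=> z1 _; apply/gE; exact: DWSNI_polefree.
- move=> z1 zi; rewrite -nE; last exact: DWSNI_polefree.
  have -> : z = (complex.Re z)%:C by apply: complex_eqP.
  by rewrite herm_sesq_Im // valVmx_real.
- move=> z1 zi; rewrite -nE; last by apply: DWSNI_polefree => //; rewrite z1.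
  exact: DWSNI_arc.
Qed.

Lemma real_form_ndecr G v (a b : R) : tf_symmetric G ->
  (forall x : R, -1 <= x <= 1 -> polefree G x%:C) ->
  (forall u, normc u < 1 -> 0 < complex.Im u -> polefree G u /\
     0 <= complex.Im (sesq (valVmx G u) v v)) ->
  -1 <= a -> a <= b -> b <= 1 ->
  complex.Re (sesq (valVmx G a%:C) v v) <= complex.Re (sesq (valVmx G b%:C) v v).
Proof.
move=> sG gG iG a1 ab b1; have [g gE /(_ v)[n nE]] := valVmx_form G.
have gx (x : R) : -1 <= x <= 1 -> g.[x%:C] != 0 by move=> /gG/gE.
rewrite !nE; try by apply: gG; rewrite ?a1 ?b1 ?(le_trans ab b1) ?(le_trans a1 ab).
apply: segment_ndecr => // [x x1|u ult ui].
  by rewrite -nE ?herm_sesq_Im ?valVmx_real //; exact: gG.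
by have [gu iu] := iG u ult ui; rewrite -nE.
Qed.

Lemma real_form_incr G v (a b : R) : tf_symmetric G ->
  (forall x : R, -1 <= x <= 1 -> polefree G x%:C) ->
  (forall u, normc u < 1 -> 0 < complex.Im u -> polefree G u /\
     0 < complex.Im (sesq (valVmx G u) v v)) ->
  -1 <= a -> a < b -> b <= 1 ->
  complex.Re (sesq (valVmx G a%:C) v v) < complex.Re (sesq (valVmx G b%:C) v v).
Proof.
move=> sG gG iG a1 ab b1; have [g gE /(_ v)[n nE]] := valVmx_form G.
have gx (x : R) : -1 <= x <= 1 -> g.[x%:C] != 0 by move=> /gG/gE.
have ab' := ltW ab.
rewrite !nE; try by apply: gG; rewrite ?a1 ?b1 ?(le_trans ab' b1) ?(le_trans a1 ab').
apply: segment_incr => // [x x1|u ult ui|u ult ui].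
- by rewrite -nE ?herm_sesq_Im ?valVmx_real //; exact: gG.
- by have [gu iu] := iG u ult ui; rewrite -nE // ltW.
- by have [gu iu] := iG u ult ui; split; [exact/gE | rewrite -nE].
Qed.

End NegativeImaginary.

(** * The stability criterion *)

Section Criterion.
Context {R : realType} {m : nat}.
Local Notation C := R[i].
Variables P Q : tfmx R m.
Hypothesis P_symmetric : tf_symmetric P.
Hypothesis P_proper : tf_proper P.
Hypothesis P_DNI : D_NI P.
Hypothesis P_no_pole_1 : ~ tf_pole P 1.
Hypothesis P_no_pole_N1 : ~ tf_pole P (-1).
Hypothesis Q_symmetric : tf_symmetric Q.
Hypothesis Q_DWSNI : D_WSNI Q.
Hypothesis PQ_N1 : tf_eval P (-1) *m tf_eval Q (-1) = 0.
Hypothesis Q_N1 : psdmx (tf_eval Q (-1)).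

Let A (x : R) := valVmx P x%:C.
Let B (x : R) := valVmx Q x%:C.

Lemma polefree_P x : -1 <= x <= 1 -> polefree P x%:C.
Proof.
move=> /andP[x1 x2].
have [->|xn1] := eqVneq x (-1).
  apply/polefree_pole; first by rewrite fmorph_eq0 oppr_eq0 oner_eq0.
  by rewrite rmorphN1 invrN1.
have [->|x1'] := eqVneq x 1.
  by apply/polefree_pole; rewrite ?fmorph_eq0 ?oner_eq0 // rmorph1 invr1.
apply: DNI_polefree => //; rewrite normc_real_lt1.
by apply/andP; split; [rewrite lt_def xn1 | rewrite lt_def eq_sym x1'].
Qed.

Lemma polefree_Q x : -1 <= x <= 1 -> polefree Q x%:C.
Proof. by rewrite -normc_real_le1; exact: DWSNI_polefree. Qed.

Lemma evalP1 : tf_eval P 1 = A 1.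
Proof. by rewrite /A valVmx_eval rmorph1 ?oner_eq0 // invr1. Qed.

Lemma evalQ1 : tf_eval Q 1 = B 1.
Proof. by rewrite /B valVmx_eval rmorph1 ?oner_eq0 // invr1. Qed.

Lemma evalPN1 : tf_eval P (-1) = A (-1).
Proof. by rewrite /A valVmx_eval rmorphN1 ?oppr_eq0 ?oner_eq0 // invrN1. Qed.

Lemma evalQN1 : tf_eval Q (-1) = B (-1).
Proof. by rewrite /B valVmx_eval rmorphN1 ?oppr_eq0 ?oner_eq0 // invrN1. Qed.

Let AA x : (A x)^t* = A x.
Proof. exact: valVmx_real. Qed.

Let BB x : (B x)^t* = B x.
Proof. exact: valVmx_real. Qed.

Lemma A_ndecr v a b : -1 <= a -> a <= b -> b <= 1 ->
  complex.Re (sesq (A a) v v) <= complex.Re (sesq (A b) v v).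
Proof.
move=> a1 ab b1; apply: real_form_ndecr => // [|u ult ui]; first exact: polefree_P.
by split; [exact: DNI_polefree | exact: DNI_Im].
Qed.

Lemma B_incr v a b : v != 0 -> -1 <= a -> a < b -> b <= 1 ->
  complex.Re (sesq (B a) v v) < complex.Re (sesq (B b) v v).
Proof.
move=> v0 a1 ab b1; apply: real_form_incr => // [|u ult ui]; first exact: polefree_Q.
by split; [apply: DWSNI_polefree => //; exact: ltW | apply: DWSNI_Im => //; exact: ltW].
Qed.

Lemma B_ndecr v a b : -1 <= a -> a <= b -> b <= 1 ->
  complex.Re (sesq (B a) v v) <= complex.Re (sesq (B b) v v).
Proof.
move=> a1 + b1; rewrite le_eqVlt => /orP[/eqP -> //|ab].
have [->|v0] := eqVneq v 0; first by rewrite !sesq0r.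
exact/ltW/B_incr.
Qed.

Lemma B_pd x : -1 < x -> x <= 1 -> pdmx (B x).
Proof.
move=> x1 x2; apply/pdmxP; split=> // v v0.
have := Q_N1; rewrite evalQN1 => /psdmxP[_ /(_ v)] h.
by apply: (le_lt_trans h); exact: B_incr.
Qed.

Let nonsingular x := forall w : 'cV[C]_m, A x *m B x *m w = w -> w = 0.

Lemma nonsingular_N1 : nonsingular (-1).
Proof. by move=> w; rewrite -evalPN1 -evalQN1 PQ_N1 mul0mx. Qed.

(** The product of the loop and its inverse is the identity at points x + t with
    t > 0 small, hence at x by continuity of both factors. *)
Lemma stable_nonsingular x : internally_stable P Q -> -1 <= x <= 1 -> nonsingular x.
Proof.
move=> [[Lu Tproper] Tpole] x1; apply/loop_at_injP.
have gT : polefree (closed_loop P Q) x%:C.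
  have [x0|x0] := eqVneq x%:C (0 : C); first by rewrite x0; exact/polefree_proper.
  apply/polefree_pole => // /Tpole; rewrite normr_lt1 normcV.
  apply/negP; rewrite -leNgt.
  by rewrite invf_ge1 ?normc_real_le1 // lt_def normc_eq0 x0 normc_ge0.
have line := ccvg_line_right x%:C (1 : C).
have gM := valVmxM (loop_mx P Q) (closed_loop P Q).
rewrite /closed_loop mulmxV // -/(closed_loop P Q) in gM.
have g := generic_and (generic_and gM (valVmx1 (m + m))) (valVmx_loop P Q).
have near1 := generic_line x%:C g (oner_neq0 C).
pose T u := loop_at (valVmx P u) (valVmx Q u) *m valVmx (closed_loop P Q) u.
have lim : mcvg (0^'+) (fun t : R => T (x%:C + t%:C * 1)) (T x%:C).
  apply: mcvg_mul; last exact: valVmx_cvg.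
  exact: loop_at_cvg (polefree_P x1) (polefree_Q x1) line.
have LT : T x%:C = 1%:M.
  apply/matrixP => i j; apply: (ccvg_unique (lim i j)).
  have one_cvg : ccvg (0^'+) (fun _ : R => (1%:M : 'M[C]_(m + m)) i j)
      ((1%:M : 'M[C]_(m + m)) i j) by split; exact: cvg_cst.
  apply: near_eq_ccvg one_cvg; apply: filterS near1 => t [[gt one] lt].
  by rewrite /T -lt -gt one.
by apply/unitmx_cVP; have [] := mulmx1_unit LT.
Qed.

(** The segment (1 - t) u stays in the open disc, where the D-NI inequality holds
    although P may have a pole at u; the strict inequality for Q at u persists
    nearby with half the constant. *)
Lemma near_energy u : normc u <= 1 -> 0 < complex.Im u ->
  exists2 d : R, 0 < d & exists b : R, \forall t \near (0 : R)^'+,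
   [/\ forall v, 0 <= complex.Im (sesq (valVmx P (u + t%:C * - u)) v v),
       forall v, d * l1norm v ^+ 2 <=
         complex.Im (sesq (valVmx Q (u + t%:C * - u)) v v) &
       l1norm (valVmx Q (u + t%:C * - u)) <= b].
Proof.
move=> u1 ui; have u0 := Im_gt0_neq0 ui.
have [d d0 hd] := Im_sesq_coercive
  (fun v => DWSNI_Im Q_DWSNI Q_symmetric u1 ui (v := v)).
have line := ccvg_line_right u (- u).
have gQ : polefree Q u by exact: DWSNI_polefree.
have d2 : 0 < d / 2 by rewrite divr_gt0.
have nearQ : \forall t \near (0 : R)^'+,
    l1norm (valVmx Q (u + t%:C * - u) - valVmx Q u) < d / 2.
  exact: mcvg_l1norm (valVmx_cvg gQ line) _ d2.
have nearI : \forall t \near (0 : R)^'+, 0 < complex.Im (u + t%:C * - u).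
  exact: (@cvgr_gt R R _ _ _ _ (proj2 line) _ ui).
have near1 : \forall t \near (0 : R)^'+, t < 1 by exact: nbhs_right_lt.
have near0 := @near_right_gt0 R.
exists (d / 2) => //; exists (l1norm (valVmx Q u) + d / 2).
apply: filterS (filterI (filterI nearQ nearI) (filterI near1 near0)).
move=> t [[hq hi] [t1 t0]].
have QE : valVmx Q (u + t%:C * - u) =
    valVmx Q u + (valVmx Q (u + t%:C * - u) - valVmx Q u).
  by rewrite [RHS]addrC subrK.
split.
- move=> v; apply: DNI_Im => //.
  have -> : u + t%:C * - u = (1 - t)%:C * u by rewrite rmorphB rmorph1; ring.
  have -> : normc ((1 - t)%:C * u) = (1 - t) * normc u.
    rewrite normcM normc_sqrt /= expr0n addr0 sqrtr_sqr ger0_norm //.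
    by rewrite subr_ge0 ltW.
  apply: (@le_lt_trans _ _ (1 - t)); last by rewrite gtrBl.
  by rewrite ler_piMr // subr_ge0 ltW.
- move=> v; rewrite QE sesqMDl cImD; have := hd v.
  have : - complex.Im (sesq (valVmx Q (u + t%:C * - u) - valVmx Q u) v v) <=
      d / 2 * l1norm v ^+ 2.
    apply: (le_trans (normc_geNIm _)); apply: (le_trans (normc_sesq _ _ _)).
    by rewrite -expr2 ler_wpM2r ?sqr_ge0 // ltW.
  have -> : d * l1norm v ^+ 2 = d / 2 * l1norm v ^+ 2 + d / 2 * l1norm v ^+ 2 by field.
  move=> h1 h2; rewrite -(lerD2r (d / 2 * l1norm v ^+ 2)); apply: (le_trans h2).
  by rewrite -addrA lerDl -lerBlDl sub0r.
- by rewrite QE; apply: (le_trans (l1normD _ _)); rewrite lerD2l ltW.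
Qed.

Lemma nonreal_polefree u : normc u <= 1 -> 0 < complex.Im u ->
  loop_mx P Q \in unitmx /\ polefree (closed_loop P Q) u.
Proof.
move=> u1 ui; have [d d0 [b est]] := near_energy u1 ui.
have a0 : - u != 0 by rewrite oppr_eq0 Im_gt0_neq0.
have Lu : loop_mx P Q \in unitmx.
  apply: (loop_unit (u0 := u) a0); apply: filterS est => t [h1 h2 _].
  exact: energy_inj d0 h1 h2.
split=> //; apply: (closed_loop_polefree (K := inverse_bound d b) Lu a0).
apply: filterS est => t [h1 h2 h3] X LX.
exact: energy_inverse d0 h1 h2 h3 LX.
Qed.

(** Nonreal points are covered by [nonreal_polefree] and conjugation, real points
    by continuity of the loop, since P and Q have no poles there. *)
Lemma nonsingular_stable : (forall x, -1 <= x <= 1 -> nonsingular x) ->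
  internally_stable P Q.
Proof.
move=> ns.
(* Any nonreal point shows that the loop matrix is invertible. *)
have i1 : normc ('i%C : C) <= 1 by rewrite /= expr0n expr1n add0r sqrtr1.
have [Lu _] := nonreal_polefree i1 ltr01.
have gT u : normc u <= 1 -> polefree (closed_loop P Q) u.
  move=> u1; have [ui|ui|ui] := ltgtP (complex.Im u) 0.
  - have ui' : 0 < complex.Im u^* by rewrite cImJ oppr_gt0.
    have u1' : normc u^* <= 1 by rewrite normc_conj.
    have [_ g] := nonreal_polefree u1' ui'.
    by move=> i j; rewrite -denV_conj; exact: g.
  - by have [] := nonreal_polefree u1 ui.
  have uE : u = (complex.Re u)%:C by apply: complex_eqP.
  have u1' : -1 <= complex.Re u <= 1 by rewrite -normc_real_le1 -uE.
  have [|K hK] := regular_bound (1 : C) (polefree_P u1') (polefree_Q u1') _.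
    exact/loop_at_injP/ns.
  by rewrite uE; exact: (closed_loop_polefree Lu (oner_neq0 C) hK).
split; first by split=> //; apply/polefree_proper/gT; rewrite normc0 ler01.
move=> z zp; rewrite normr_lt1 ltNge; apply/negP => z1.
have z0 : z != 0 by rewrite -normc_eq0 gt_eqF // (lt_le_trans ltr01 z1).
have zi : z^-1 != 0 by rewrite invr_eq0.
have : polefree (closed_loop P Q) z^-1.
  by apply: gT; rewrite normcV invf_le1 // (lt_le_trans ltr01 z1).
by move/(polefree_pole _ zi); rewrite invrK.
Qed.

Let form_pd x := pdmx (B x - B x *m A x *m B x).

Lemma form_pd_nonsingular : form_pd 1 -> forall x, -1 <= x <= 1 -> nonsingular x.
Proof.
move=> pM x /andP[x1 x2] w; move: x1; rewrite le_eqVlt => /orP[/eqP <-|x1].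
  exact: nonsingular_N1.
apply: (@nonsingular_mono _ _ (A x) (B x) (A 1) (B 1) w _ _ _ _ pM).
- exact: B_pd.
- by apply: B_pd; rewrite // (lt_le_trans x1).
- by move=> v; apply: A_ndecr; rewrite // ltW.
- by move=> v; apply: B_ndecr; rewrite // ltW.
Qed.

(** The path of [pd_path] cannot start at -1, where B may be singular; it starts
    at a nearby t0 where the product A B is small. *)
Lemma nonsingular_form_pd : (forall x, -1 <= x <= 1 -> nonsingular x) -> form_pd 1.
Proof.
move=> ns.
have line := ccvg_line_right (-1)%:C (1 : C).
have n1 : -1 <= (-1 : R) <= 1 by rewrite lexx; lra.
pose M u := valVmx P u *m valVmx Q u.
have lim : mcvg (0^'+) (fun t : R => M ((-1)%:C + t%:C * 1)) (M (-1)%:C).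
  by apply: mcvg_mul; apply: valVmx_cvg line; [exact: polefree_P | exact: polefree_Q].
have MN1 : M (-1)%:C = 0 by rewrite -[LHS]/(A (-1) *m B (-1)) -evalPN1 -evalQN1.
have near1 : \forall t \near (0 : R)^'+, l1norm (A (-1 + t) *m B (-1 + t)) < 1.
  have near0 : \forall t \near (0 : R)^'+,
      l1norm (M ((-1)%:C + t%:C * 1) - M (-1)%:C) < 1.
    exact: mcvg_l1norm lim _ ltr01.
  by apply: filterS near0 => t; rewrite MN1 subr0 mulr1 -rmorphD.
have near2 : \forall t \near (0 : R)^'+, t < 1 by exact: nbhs_right_lt.
have [s [hs [s1 s0]]] := filter_ex (filterI near1 (filterI near2 (@near_right_gt0 R))).
pose t0 := -1 + s.
have t0l : -1 < t0 by rewrite ltrDl.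
have t0r : t0 <= 1 by rewrite /t0; lra.
pose c (t : R) := Num.max t0 (Num.min 1 t).
have c_in t : t0 <= c t <= 1 by exact: clamp_itv.
have c_lt t : -1 < c t by have /andP[h _] := c_in t; exact: lt_le_trans t0l h.
have c_in' t : -1 <= c t <= 1 by have /andP[_ ->] := c_in t; rewrite ltW.
have c1 : c 1 = 1 by rewrite /c minxx max_r.
have ct0 : c t0 = t0 by rewrite /c min_r // maxxx.
suff : pdmx (B (c 1) - B (c 1) *m A (c 1) *m B (c 1)) by rewrite c1.
apply: (@pd_path R m (fun t => B (c t) - B (c t) *m A (c t) *m B (c t)) t0 1).
- move=> t; have cc : ccvg (nbhs t) (fun t => (c t)%:C) (c t)%:C.
    by split; [exact: clamp_cont | exact: cvg_cst].
  have cA : mcvg (nbhs t) (fun s => A (c s)) (A (c t)).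
    exact: valVmx_cvg (polefree_P (c_in' t)) cc.
  have cB : mcvg (nbhs t) (fun s => B (c s)) (B (c t)).
    exact: valVmx_cvg (polefree_Q (c_in' t)) cc.
  by apply: mcvgB; [exact: cB | exact: mcvg_mul (mcvg_mul cB cA) cB].
- by move=> t; rewrite adjB herm_BAB // BB.
- move=> t v Mv; apply: (ns (c t)) => //.
  have pB : pdmx (B (c t)) by apply: B_pd => //; have /andP[] := c_in t.
  apply/eqP; rewrite eq_sym -subr_eq0; apply/eqP; apply: (pd_inj pB).
  by rewrite -Mv mulmxBr mulmxBl !mulmxA.
- by rewrite ct0; apply: form_of_small => //; apply: B_pd.
Qed.

Lemma stable_iff_form_pd : internally_stable P Q <-> form_pd 1.
Proof.
split=> [st|pM]; last exact: nonsingular_stable (form_pd_nonsingular pM).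
by apply: nonsingular_form_pd => x; exact: stable_nonsingular.
Qed.

Lemma dc_gain_criterion : (0 < m)%N ->
  has_real_spectrum (A 1 *m B 1) /\
  (internally_stable P Q <-> largest_eigenvalue (A 1 *m B 1) < 1).
Proof.
move=> m0; have pB : pdmx (B 1) by apply: B_pd => //; lra.
have rs : has_real_spectrum (A 1 *m B 1).
  by move=> a /(eig_real (AA 1) pB); case: a => a b /= ->; rewrite complex_real.
split=> //; rewrite stable_iff_form_pd (largest_eigenvalue_lt1 m0 rs).
split=> [pM a ea|lt1]; first exact: eig_lt1_of_form (AA 1) pB pM ea.
exact: form_of_eig (AA 1) pB lt1.
Qed.

End Criterion.

Unset Implicit Arguments.

Theorem theorem8 (R : realType) (m : nat) (P Q : tfmx R m)
    (m_gt0 : (0 < m)%N)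
    (P_symmetric : tf_symmetric P) (P_proper : tf_proper P) (P_DNI : D_NI P)
    (P_no_pole_1 : ~ tf_pole P 1) (P_no_pole_N1 : ~ tf_pole P (-1))
    (Q_symmetric : tf_symmetric Q) (Q_proper : tf_proper Q)
    (Q_DWSNI : D_WSNI Q)
    (PQ_N1 : tf_eval P (-1) *m tf_eval Q (-1) = 0)
    (Q_N1 : psdmx (tf_eval Q (-1))) :
  has_real_spectrum (tf_eval P 1 *m tf_eval Q 1) /\
  (internally_stable P Q <->
   largest_eigenvalue (tf_eval P 1 *m tf_eval Q 1) < 1).
Proof.
rewrite (evalP1 P) (evalQ1 Q).
exact: (dc_gain_criterion P_symmetric P_proper P_DNI P_no_pole_1 P_no_pole_N1
  Q_symmetric Q_DWSNI PQ_N1 Q_N1 m_gt0).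
Qed.
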